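(* Let $\bar\rho$ be the solution on $\mathbb{R}^2\times[0,\infty)$ of the 2D Navier–Stokes equation in vorticity form $$\partial_t\bar\rho+(K*\bar\rho)\cdot\nabla\bar\rho=\Delta\bar\rho,\qquad \bar\rho(\cdot,0)=\bar\rho_0,\qquad K(x)=\frac1{2\pi}\frac{(-x_2,x_1)}{|x|^2}.$$ Assume that $\bar\rho_0\in W^{2,\infty}(\mathbb{R}^2)$ is a probability density satisfying, for some positive constants $C_1,C_2,C_3$ and all $x\in\mathbb{R}^2$, $$|\nabla\log\bar\rho_0(x)|^2\le C_1(1+|x|^2),\qquad |\nabla^2\log\bar\rho_0(x)|\le C_2(1+|x|^2),\qquad \bar\rho_0(x)\le C_3\exp(-C_3^{-1}|x|^2).$$ Then there exists a constant $C_2'$, depending on $C_3$, such that for all $x\in\mathbb{R}^2$ and $t\ge0$ $$\bar\rho(x,t)\le\frac{C_2'}{t\vee1}\exp\Big(-\frac{|x|^2}{8t+C_2'}\Big).$$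
   Context: Here $t\vee1=\max(t,1)$. The viscosity is normalized to $\sigma=1$, and it is assumed throughout that $\bar\rho\ge0$, $\int_{\mathbb{R}^2}\bar\rho(x,t)\,dx=1$ and $\bar\rho\in L^1\cap L^\infty(\mathbb{R}^2)$ in space; then $\bar\rho$ is smooth and a classical solution for $t>0$. Convolution is in the space variable. *)

(* Defs.v *)
From HB Require Import structures.
From mathcomp Require Import all_boot all_order all_algebra.
From mathcomp Require Import all_classical all_reals all_analysis.

Set Implicit Arguments.
Unset Strict Implicit.
Unset Printing Implicit Defensive.
Import Order.TTheory GRing.Theory Num.Theory.
Import numFieldNormedType.Exports.
Local Open Scope classical_set_scope.
Local Open Scope ring_scope.

(* The plane is R * R; its coordinates are indexed by bool, false for the first
   one and true for the second. *)
Definition unit_vec {R : realType} (i : bool) : R * R :=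
  if i then (0, 1) else (1, 0).

(* The library norm on R * R is the max norm, so |x|^2 is spelled out. *)
Definition sqnorm {R : realType} (x : R * R) : R := x.1 ^+ 2 + x.2 ^+ 2.

Definition leb2 {R : realType} :
    {measure set (measurableTypeR R * measurableTypeR R) -> \bar R} :=
  (@lebesgue_measure R \x @lebesgue_measure R)%E.

Definition partial {R : realType} (i : bool) (f : R * R -> R) : R * R -> R :=
  fun x => 'D_(unit_vec i) f x.

Definition partials {R : realType} (s : seq bool) (f : R * R -> R) :
  R * R -> R := foldr partial f s.

Definition test_function {R : realType} (phi : R * R -> R) : Prop :=
  (forall (s : seq bool) (x : R * R), differentiable (partials s phi) x) /\
  compact (closure [set x | phi x != 0]).

(* g is the distributional derivative of f for the word s of partials; it is
   only used below for locally integrable f and g. *)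
Definition weak_partials {R : realType} (s : seq bool) (f g : R * R -> R) :
  Prop :=
  forall phi : R * R -> R, test_function phi ->
    \int[leb2]_x (f x * partials s phi x) =
    (-1) ^+ size s * \int[leb2]_x (g x * phi x).

Definition W2oo {R : realType} (f : R * R -> R) : Prop :=
  f \in Lfun leb2 +oo%E /\
  forall s : seq bool, (0 < size s <= 2)%N ->
    exists2 g : R * R -> R, g \in Lfun leb2 +oo%E & weak_partials s f g.

Definition probability_density {R : realType} (f : R * R -> R) : Prop :=
  [/\ measurable_fun [set: measurableTypeR R * measurableTypeR R] f,
      (forall x, 0 <= f x) &
      (\int[leb2]_x (f x)%:E = 1)%E].

(* |nabla log f|^2 <= C (1 + |x|^2) everywhere; this presupposes f > 0. *)
Definition grad_log_bound {R : realType} (C : R) (f : R * R -> R) : Prop :=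
  forall x : R * R,
    [/\ 0 < f x, differentiable (fun y => ln (f y)) x &
        \sum_(i : bool) partial i (fun y => ln (f y)) x ^+ 2
          <= C * (1 + sqnorm x)].

(* |nabla^2 log f| <= C (1 + |x|^2) with the Frobenius norm. For f in
   W^{2,oo} the Hessian is a distributional one, defined almost everywhere. *)
Definition hess_log_bound {R : realType} (C : R) (f : R * R -> R) : Prop :=
  exists h : bool -> bool -> R * R -> R,
    [/\ (forall i j,
           measurable_fun [set: measurableTypeR R * measurableTypeR R] (h i j)),
        (forall i j, weak_partials [:: i; j] (fun y => ln (f y)) (h i j)) &
        {ae leb2, forall x, Num.sqrt (\sum_(i : bool) \sum_(j : bool)
                              h i j x ^+ 2) <= C * (1 + sqnorm x)}].

(* The Biot-Savart kernel; its value at the origin is 0 as 0^-1 = 0. *)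
Definition biot_savart {R : realType} (i : bool) (x : R * R) : R :=
  (2 * pi)^-1 * ((if i then x.1 else - x.2) / sqnorm x).

Definition velocity {R : realType} (f : R * R -> R) (i : bool) (x : R * R) : R :=
  \int[leb2]_y (biot_savart i (x.1 - y.1, x.2 - y.2) * f y).

(* C^2 in space and C^1 in time on the open set t > 0, jointly in (x, t). *)
Definition classical_C21 {R : realType} (rho : R * R -> R -> R) : Prop :=
  forall (x : R * R) (t : R), 0 < t ->
    [/\ derivable (rho x) t 1,
        (forall s : seq bool, (size s <= 1)%N ->
           differentiable (partials s (rho ^~ t)) x),
        {for (x, t), continuous (fun z : (R * R) * R => derive1 (rho z.1) z.2)} &
        (forall s : seq bool, (size s <= 2)%N ->
           {for (x, t), continuous
             (fun z : (R * R) * R => partials s (rho ^~ z.2) z.1)})].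

(* rho x t is the solution at position x and time t; only t >= 0 matters. *)
Record NS_vorticity_solution {R : realType} (rho0 : R * R -> R)
    (rho : R * R -> R -> R) : Prop := {
  NS_ge0 : forall (x : R * R) (t : R), 0 <= t -> 0 <= rho x t;
  NS_mass : forall t : R, 0 <= t -> (\int[leb2]_x (rho x t)%:E = 1)%E;
  (* rho is in L^oo(R^2) in space, uniformly on bounded time intervals *)
  NS_bounded : forall T : R, exists M : R,
    forall (x : R * R) (t : R), 0 <= t <= T -> rho x t <= M;
  NS_regular : classical_C21 rho;
  NS_equation : forall (x : R * R) (t : R), 0 < t ->
    derive1 (rho x) t
    + \sum_(i : bool) velocity (rho ^~ t) i x * partial i (rho ^~ t) x
    = \sum_(i : bool) partials [:: i; i] (rho ^~ t) x;
  NS_initial : forall x : R * R, rho x 0 = rho0 x;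
  (* the initial datum is attained in L^1(R^2) *)
  NS_initial_cvg :
    (\int[leb2]_x `|rho x t - rho0 x|%:E)%E @[t --> 0^'+] --> 0%E }.

(* Main.v *)
(* The proof uses the maximum principle only.  Let M(t) be the supremum of
   rho(., t) and k the heat kernel.
   - Unit mass and the bound M give |u| <= c sqrt M.
   - Decay: k(t - s) * rho(s) solves the equation up to u . grad(k * rho(s)), of
     size at most c sqrt M . M / sqrt (pi (t - s)), so adding the time integral of
     this quantity makes it a supersolution; no derivative of rho is involved.
     As k(t - s) * rho(s) <= 1 / (4 pi (t - s)), the choice t - s = 1 / (4 M(s))
     gives M(t) <= q M(s) with q < 1 (this needs a numerical margin, which mass 1
     and viscosity 1 leave).  Iterating, M(t) <= N / t.
   - The same supersolution started at s -> 0 shows that rho is below a Gaussian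
     up to O(sqrt t), which is how the initial datum, attained in L^1 only, is
     used in pointwise comparisons.
   - Gaussian bound: a multiple of k(2 t + C / 4) is a supersolution where
     |x|^2 >= r^2 (8 t + C), since |u| = O(t^(-1/2)), and dominates N / t
     elsewhere. *)

Require Import Defs.
From HB Require Import structures.
From mathcomp Require Import all_boot all_order all_algebra.
From mathcomp Require Import all_classical all_reals all_analysis.
From mathcomp Require Import measurable_realfun.
From mathcomp Require Import ring lra.
Set Implicit Arguments.
Unset Strict Implicit.
Unset Printing Implicit Defensive.
Import Order.TTheory GRing.Theory Num.Theory.
Import numFieldNormedType.Exports.
Local Open Scope classical_set_scope.
Local Open Scope ring_scope.

(** * Maximum principle *)

(** No decay of rho or of its derivatives at infinity is assumed, so a supremum over the plane need
    not be attained. Every comparison is therefore made in a finite box, with a quadratic barrier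
    that is small at a prescribed point and exceeds the bound of rho on the sides of the box. The
    factor q cannot be improved by rescaling: M(s) is an inverse time, and at t - s = 1 / (4 M(s))
    the heat term and the drift term are both pure multiples of M(s). To keep the constants small,
    the velocity is estimated in the sum of its two components, and the gradient of the heat flow
    component by component, with the exact L^1 norm of the kernel derivative. The 8 t of the
    conclusion, instead of the 4 t of the heat kernel, pays for the drift: the kernel run at double
    speed satisfies W_t = 2 Delta W, and for large |x|^2 / t the spare Delta W is of order |x|^2 /
    t^2 times W, against |x| / t^(3/2) times W for the drift. *)

Lemma is_derive_line (R : realType) (V : normedModType R) (g : V -> R)
    (x e : V) (h a : R) :
  is_derive h 1 (fun r => g (x + r *: e)) a <-> is_derive (x + h *: e) e g a.
Proof.
have E : (fun r : R => r^-1 *: (((fun r => g (x + r *: e)) \o shift h) (r *: 1)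
                        - g (x + h *: e))) =
         (fun r : R => r^-1 *: ((g \o shift (x + h *: e)) (r *: e) - g (x + h *: e))).
  apply/funext => r /=; congr (_ *: (g _ - _)).
  by rewrite scalerDl addrCA [in LHS]/GRing.scale/= mulr1.
split=> -[dg da]; apply: DeriveDef.
- by rewrite /derivable -E.
- by rewrite /derive -E.
- by rewrite /derivable E.
- by rewrite /derive E.
Qed.

(** [F'] is only known to be differentiable at 0, so Taylor expansion is avoided: if [b] were
    positive, [F'] would be positive just to the right of 0, and the mean value theorem would make
    [F] exceed [F 0] there. *)
Lemma second_derivative_at_max (R : realType) (F F' : R -> R) (b d : R) :
  0 < d -> (forall h : R, `|h| < d -> is_derive h 1 F (F' h)) ->
  is_derive (0 : R) 1 F' b -> (forall h, `|h| < d -> F h <= F 0) ->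
  F' 0 = 0 /\ b <= 0.
Proof.
move=> d0 dF dF' Fmax.
have Fd0 : F' 0 = 0.
  have H0 : is_derive (0 : R) 1 F 0.
    apply: (@derive1_at_max _ F (- d) d); first lra.
    - by move=> t; rewrite in_itv/= -ltr_norml => /dF [].
    - by rewrite in_itv/=; apply/andP; split; lra.
    - by move=> t; rewrite in_itv/= -ltr_norml => /Fmax.
  have H1 : is_derive (0 : R) 1 F (F' 0) by apply: dF; rewrite normr0.
  by rewrite -(@derive_val _ _ _ _ _ _ _ H1) (@derive_val _ _ _ _ _ _ _ H0).
split=> //; rewrite leNgt; apply/negP => b0.
have : h^-1 *: ((F' \o shift 0) (h *: 1) - F' 0) @[h --> 0^'] --> b.
  by case: dF' => + <-; exact.
move/cvgrPdist_lt => /(_ _ b0) [r /= r0 H].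
pose m := Num.min (r / 2) (d / 2).
have m0 : 0 < m by rewrite lt_min; apply/andP; split; lra.
have mr : m < r by rewrite /m gt_min; apply/orP; left; lra.
have md : m < d by rewrite /m gt_min; apply/orP; right; lra.
have dFm x : x \in `]0, m[ -> is_derive x 1 F (F' x).
  rewrite in_itv/= => /andP[x0 xm]; apply: dF.
  by rewrite ger0_norm ?ltW//; lra.
have cF : {within `[0, m], continuous F}.
  apply: derivable_within_continuous => x; rewrite in_itv/= => /andP[x0 xm].
  by have [] := dF x; rewrite ?ger0_norm//; lra.
have [c + E] := @MVT _ F F' 0 m m0 dFm cF.
rewrite in_itv/= => /andP[c0 cm].
have := H c; rewrite /= sub0r normrN gtr0_norm// (lt_trans cm mr) gt_eqF//.
move=> /(_ isT isT); rewrite Fd0 subr0 addr0 [c *: 1]mulr1 => Hc.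
have Fc : 0 < F' c.
  have : 0 < c^-1 *: F' c by move: Hc; rewrite ltr_distl => /andP[? ?]; lra.
  by rewrite /GRing.scale/= pmulr_rgt0// invr_gt0.
have := Fmax m; rewrite gtr0_norm// => /(_ md).
by rewrite -subr_le0 E subr0 leNgt mulr_gt0.
Qed.

(** Only times before [t] compete, since a maximum over a time interval may sit at its right end;
    hence a sign and not a vanishing derivative. *)
Lemma derivative_ge0_at_left_max (R : realType) (F : R -> R) (t a s : R) :
  s < t -> is_derive t 1 F a -> (forall r, s <= r <= t -> F r <= F t) -> 0 <= a.
Proof.
move=> st dF Fmax; rewrite leNgt; apply/negP => a0.
have : h^-1 *: ((F \o shift t) (h *: 1) - F t) @[h --> 0^'] --> a.
  by case: dF => + <-; exact.
have na : 0 < - a by lra.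
move/cvgrPdist_lt => /(_ _ na) [r /= r0 H].
pose m := Num.min (r / 2) (t - s).
have m0 : 0 < m by rewrite lt_min; apply/andP; split; lra.
have mr : m < r by rewrite /m gt_min; apply/orP; left; lra.
have mt : m <= t - s by rewrite /m ge_min lexx orbT.
have := H (- m); rewrite /= sub0r opprK gtr0_norm// mr oppr_eq0 gt_eqF//.
move=> /(_ isT isT); rewrite [- m *: 1]mulr1 => Hc.
have Fm : F (- m + t) <= F t by apply: Fmax; apply/andP; split; lra.
have : (- m)^-1 *: (F (- m + t) - F t) < 0.
  by move: Hc; rewrite ltr_distl => /andP[? ?]; lra.
rewrite /GRing.scale/= invrN mulNr oppr_lt0 pmulr_rgt0 ?invr_gt0// subr_gt0.
by rewrite ltNge Fm.
Qed.

Definition coord {R : realType} (i : bool) (x : R * R) : R :=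
  if i then x.2 else x.1.

Lemma coord_line (R : realType) (i j : bool) (x : R * R) (h : R) :
  coord j (x + h *: unit_vec i) = coord j x + (if j == i then h else 0).
Proof.
by case: i; case: j; rewrite /coord/unit_vec/= /GRing.scale/= ?mulr1 ?mulr0.
Qed.

Lemma sqnormE (R : realType) (x : R * R) (i : bool) :
  sqnorm x = coord i x ^+ 2 + coord (~~ i) x ^+ 2.
Proof. by case: i; rewrite /sqnorm/coord/= // addrC. Qed.

Lemma sqnorm_line (R : realType) (i : bool) (x : R * R) (h : R) :
  sqnorm (x + h *: unit_vec i) = sqnorm x + 2 * h * coord i x + h ^+ 2.
Proof.
rewrite !(sqnormE _ i) !coord_line eqxx.
have -> : (~~ i == i) = false by case: i.
by rewrite addr0; ring.
Qed.

Lemma sqnorm_ge0 (R : realType) (x : R * R) : 0 <= sqnorm x.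
Proof. by rewrite addr_ge0 ?sqr_ge0. Qed.

Lemma is_derive_sqnorm (R : realType) (i : bool) (x : R * R) :
  is_derive x (unit_vec i) sqnorm (2 * coord i x).
Proof.
rewrite -[x in is_derive x]addr0 -[in is_derive _](scale0r (unit_vec i)).
apply/is_derive_line.
under eq_fun do rewrite sqnorm_line.
apply: is_derive_eq.
by rewrite /GRing.scale/= !(mulr0,mul0r,addr0,add0r,mulr1); ring.
Qed.

Lemma is_derive_coord (R : realType) (i : bool) (x : R * R) :
  is_derive x (unit_vec i) (coord i) 1.
Proof.
rewrite -[x in is_derive x]addr0 -[in is_derive _](scale0r (unit_vec i)).
apply/is_derive_line.
rewrite (_ : (fun r => _) = cst (coord i x) + id); last first.
  by apply/funext => r; rewrite coord_line eqxx.
by apply: is_derive_eq; rewrite add0r.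
Qed.

Lemma box_interior (R : realType) (a x h : R) :
  `|x| < a -> `|h| < a - `|x| -> `|x + h| <= a.
Proof. by move=> xa ha; rewrite (le_trans (ler_normD _ _))//; lra. Qed.

Lemma norm_coord_sqr_le (R : realType) (i : bool) (x : R * R) :
  `|coord i x| ^+ 2 <= sqnorm x.
Proof. by rewrite (sqnormE _ i) real_normK ?num_real// lerDl sqr_ge0. Qed.

Lemma continuous_sqnorm (R : realType) : continuous (@sqnorm R).
Proof.
rewrite (_ : sqnorm = fun x => x.1 * x.1 + x.2 * x.2); last first.
  by apply/funext => x; rewrite /sqnorm !expr2.
by move=> x; apply: cvgD; apply: cvgM; (exact: cvg_fst || exact: cvg_snd).
Qed.

Section maximum_principle.
Variables (R : realType) (rho : R * R -> R -> R) (u : bool -> R * R -> R -> R).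
Hypothesis rho_regular : classical_C21 rho.
Hypothesis rho_eq : forall (x : R * R) (t : R), 0 < t ->
  derive1 (rho x) t + \sum_(i : bool) u i x t * partial i (rho ^~ t) x
  = \sum_(i : bool) partials [:: i; i] (rho ^~ t) x.
Variables (s T U M : R).
Hypothesis s_gt0 : 0 < s.
Hypothesis u_le : forall i x t, s <= t <= T -> `|u i x t| <= U.
Hypothesis rho_le : forall x t, s <= t <= T -> rho x t <= M.

Lemma is_derive_partial (i : bool) (x : R * R) (t : R) (w : seq bool) :
  0 < t -> (size w <= 1)%N ->
  is_derive x (unit_vec i) (partials w (rho ^~ t))
    (partials (i :: w) (rho ^~ t) x).
Proof.
move=> t0 w1; apply: DeriveDef => //.
by have [_ d _ _] := @rho_regular x _ t0; apply/diff_derivable/d.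
Qed.

Lemma is_derive_time (x : R * R) (t : R) :
  0 < t -> is_derive t 1 (rho x) (derive1 (rho x) t).
Proof.
move=> t0; apply: DeriveDef; last by rewrite derive1E.
by have [d _ _ _] := @rho_regular x _ t0; exact: d.
Qed.

(** The rate has to beat the drift, at most U (2 + |x|^2) by 2 |x_i| <= 1 + x_i^2, and the Laplacian
    4 of |x|^2; 2 U + 5 does so strictly. *)
Definition barrier (e : R) (x : R * R) (t : R) : R :=
  e * expR ((2 * U + 5) * (t - s)) * (1 + sqnorm x).

Lemma is_derive_barrier_x e i x t :
  is_derive x (unit_vec i) (barrier e ^~ t)
    (e * expR ((2 * U + 5) * (t - s)) * (2 * coord i x)).
Proof.
have H := is_derive_sqnorm i x.
rewrite (_ : barrier e ^~ t =
  (e * expR ((2 * U + 5) * (t - s))) \*: (cst 1 + sqnorm)) //.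
by apply: is_derive_eq; rewrite add0r.
Qed.

Lemma is_derive_barrier_xx e i x t :
  is_derive x (unit_vec i)
    (fun x => e * expR ((2 * U + 5) * (t - s)) * (2 * coord i x))
    (e * expR ((2 * U + 5) * (t - s)) * 2).
Proof.
have H := is_derive_coord i x.
rewrite (_ : (fun x => _) =
  (e * expR ((2 * U + 5) * (t - s)) * 2) \*: (coord i : R * R -> R)).
  by apply: is_derive_eq; rewrite /GRing.scale/= mulr1.
by apply/funext => y /=; rewrite /GRing.scale/= mulrA.
Qed.

Lemma is_derive_barrier_t e x (t : R) :
  is_derive t 1 (barrier e x) ((2 * U + 5) * barrier e x t).
Proof.
rewrite (_ : barrier e x =
  (e * (1 + sqnorm x)) \*: (expR \o (fun r => (2 * U + 5) * (r - s)))).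
  by apply: is_derive_eq => /=; rewrite subr0 /GRing.scale/=; ring.
by apply/funext => r; rewrite /barrier/= /GRing.scale/=; ring.
Qed.

(* The barrier is a strict supersolution because |u . x| <= U (1 + |x|^2). *)
Lemma barrier_supersolution e x t : 0 < e -> s <= t <= T ->
  0 < (2 * U + 5) * barrier e x t
    + \sum_(i : bool) u i x t * (e * expR ((2 * U + 5) * (t - s)) * (2 * coord i x))
    - \sum_(i : bool) e * expR ((2 * U + 5) * (t - s)) * 2.
Proof.
move=> e0 tsT; rewrite /barrier.
set E := e * expR _.
have E0 : 0 < E by rewrite mulr_gt0 ?expR_gt0.
have ux i : - (U * (1 + coord i x ^+ 2)) <= u i x t * (2 * coord i x).
  rewrite -lerN2 opprK (le_trans (ler_norm _))// normrN normrM.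
  have u0 := normr_ge0 (u i x t).
  rewrite (le_trans (ler_wpM2r (normr_ge0 _) (@u_le i x _ tsT)))//.
  rewrite ler_wpM2l ?(le_trans u0 (@u_le i x _ tsT))// ler_norml.
  have := sqr_ge0 (coord i x + 1); have := sqr_ge0 (coord i x - 1).
  by rewrite !expr2 => *; apply/andP; split; lra.
have := ux false; have := ux true.
rewrite !big_bool /coord /sqnorm /= => h1 h2.
have -> : (2 * U + 5) * (E * (1 + (x.1 ^+ 2 + x.2 ^+ 2))) +
  (u true x t * (E * (2 * x.2)) + u false x t * (E * (2 * x.1))) -
  (E * 2 + E * 2) = E * ((2 * U + 5) * (1 + (x.1 ^+ 2 + x.2 ^+ 2)) +
  u true x t * (2 * x.2) + u false x t * (2 * x.1) - 4) by ring.
have U0 : 0 <= U := le_trans (normr_ge0 _) (@u_le true x _ tsT).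
rewrite mulr_gt0//.
have p1 := sqr_ge0 x.1; have p2 := sqr_ge0 x.2.
have q1 := mulr_ge0 U0 p1; have q2 := mulr_ge0 U0 p2.
by lra.
Qed.

Lemma continuous_barrier e :
  continuous (fun z : (R * R) * R => barrier e z.1 z.2).
Proof.
move=> z; rewrite /barrier; apply: cvgM.
  apply: cvgM; first exact: cvg_cst.
  apply: (@continuous_comp _ _ _ (fun z : (R * R) * R => (2 * U + 5) * (z.2 - s))).
    apply: cvgM; first exact: cvg_cst.
    by apply: cvgB; [exact: cvg_snd|exact: cvg_cst].
  exact: continuous_expR.
apply: cvgD; first exact: cvg_cst.
apply: (@continuous_comp _ _ _ (fun z : (R * R) * R => z.1)); first exact: cvg_fst.
exact: continuous_sqnorm.
Qed.

Section comparison.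
Variables (W : R * R -> R -> R) (Wx Wxx : bool -> R * R -> R -> R)
  (Wt : R * R -> R -> R) (a e : R).
Hypothesis e_gt0 : 0 < e.
Hypothesis a_large : M < e * a ^+ 2.
Hypothesis W_ge0 : forall x t, s <= t <= T -> 0 <= W x t.
Hypothesis dWx : forall i x t, s < t <= T ->
  is_derive x (unit_vec i) (W ^~ t) (Wx i x t).
Hypothesis dWxx : forall i x t, s < t <= T ->
  is_derive x (unit_vec i) (Wx i ^~ t) (Wxx i x t).
Hypothesis dWt : forall x (t : R), s < t <= T -> is_derive t 1 (W x) (Wt x t).
Hypothesis W_continuous : {within (`[- a, a] `*` `[- a, a]) `*` `[s, T],
  continuous (fun z : (R * R) * R => W z.1 z.2)}.
Hypothesis W_supersolution : forall x t, s < t <= T -> W x t < rho x t ->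
  0 <= Wt x t + \sum_(i : bool) u i x t * Wx i x t - \sum_(i : bool) Wxx i x t.
Hypothesis W_initial : forall x, (forall i, `|coord i x| <= a) ->
  rho x s <= W x s + e.

Let E t := e * expR ((2 * U + 5) * (t - s)).

Let gap (x : R * R) (t : R) := rho x t - W x t - barrier e x t.

(** At time [s] the barrier is at least [e], the slack allowed in [W_initial]; on the sides of the
    box it is at least [e * a ^+ 2], which exceeds [M]. *)
Lemma gap_le0_parabolic_boundary x t : s <= t <= T ->
  (forall i, `|coord i x| <= a) ->
  t = s \/ (exists i, `|coord i x| = a) -> gap x t <= 0.
Proof.
move=> tsT xa [->|[i xia]].
  rewrite /gap /barrier subrr mulr0 expR0 mulr1.
  have := W_initial xa; have := mulr_ge0 (ltW e_gt0) (sqnorm_ge0 x); lra.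
have := rho_le x tsT; have := W_ge0 x tsT; have := norm_coord_sqr_le i x.
rewrite /gap /barrier xia => h1 h2 h3.
have U0 : 0 <= U := le_trans (normr_ge0 _) (u_le true x tsT).
have /andP[st _] := tsT.
have : e * a ^+ 2 <= e * expR ((2 * U + 5) * (t - s)) * (1 + sqnorm x).
  apply: ler_pM; rewrite ?sqr_ge0 ?(ltW e_gt0)//; last lra.
  rewrite -[leLHS]mulr1 ler_pM2l// -[leLHS]expR0 ler_expR; apply: mulr_ge0; lra.
have := a_large; lra.
Qed.

(** At such a maximum the gradients of [rho] and of [W] plus the barrier agree, the second
    derivatives are ordered, and so are the time derivatives. Inserted in the equation for [rho],
    this contradicts the strictness of the barrier. *)
Lemma gap_no_interior_max x t : s < t <= T -> (forall i, `|coord i x| < a) ->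
  0 < gap x t ->
  ~ (forall y r, s <= r <= T -> (forall i, `|coord i y| <= a) ->
     gap y r <= gap x t).
Proof.
move=> /[dup] stT /andP[st tT] xa gap0 gmax.
have t0 : 0 < t by rewrite (lt_trans s_gt0).
have tsT : s <= t <= T by rewrite ltW.
have E0 : 0 < E t by rewrite mulr_gt0 ?expR_gt0.
have B0 : 0 <= barrier e x t.
  by rewrite mulr_ge0 ?(ltW E0)// addr_ge0 ?sqnorm_ge0.
(* This is why [W_supersolution] may be restricted to the points where [W] is below [rho]. *)
have Wrho : W x t < rho x t by rewrite /gap in gap0; lra.
have space i : partial i (rho ^~ t) x = Wx i x t + E t * (2 * coord i x) /\
    partials [:: i; i] (rho ^~ t) x <= Wxx i x t + E t * 2.
  pose F h := gap (x + h *: unit_vec i) t.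
  pose F' h := partial i (rho ^~ t) (x + h *: unit_vec i)
     - Wx i (x + h *: unit_vec i) t - E t * (2 * coord i (x + h *: unit_vec i)).
  pose b := partials [:: i; i] (rho ^~ t) x - Wxx i x t - E t * 2.
  have Fmax (h : R) : `|h| < a - `|coord i x| -> F h <= F 0.
    move=> ha; rewrite /F scale0r addr0; apply: gmax => // j.
    rewrite coord_line; case: eqP => [->|_]; first exact: box_interior.
    by rewrite addr0 ltW.
  have dF (h : R) : `|h| < a - `|coord i x| -> is_derive h 1 F (F' h).
    move=> _; apply/(is_derive_line (gap ^~ t)).
    have h1 := @is_derive_partial i (x + h *: unit_vec i) t [::] t0 isT.
    have h2 := dWx i (x + h *: unit_vec i) stT.
    have h3 := is_derive_barrier_x e i (x + h *: unit_vec i) t.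
    by apply: is_deriveB; apply: is_deriveB.
  have dF' : is_derive (0 : R) 1 F' b.
    apply/(is_derive_line (fun y => partial i (rho ^~ t) y - Wx i y t -
      E t * (2 * coord i y))); rewrite scale0r addr0.
    have h1 := @is_derive_partial i x t [:: i] t0 isT.
    have h2 := dWxx i x stT.
    have h3 := is_derive_barrier_xx e i x t.
    by apply: is_deriveB; apply: is_deriveB.
  have d0 : 0 < a - `|coord i x| by rewrite subr_gt0.
  have [] := second_derivative_at_max d0 dF dF' Fmax.
  by rewrite /F' /b scale0r addr0; split; lra.
have time : Wt x t + (2 * U + 5) * barrier e x t <= derive1 (rho x) t.
  have h1 := is_derive_time x t0; have h2 := dWt x stT.
  have h3 := is_derive_barrier_t e x t.
  have d : is_derive t 1 (gap x)
      (derive1 (rho x) t - Wt x t - (2 * U + 5) * barrier e x t).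
    by apply: is_deriveB; apply: is_deriveB.
  have := derivative_ge0_at_left_max st d.
  rewrite -addrA -opprD subr_ge0; apply=> r /andP[sr rt].
  by apply: gmax => [|i]; [rewrite sr (le_trans rt)|exact/ltW].
have := rho_eq x t0; have := W_supersolution stT Wrho.
have := barrier_supersolution x e_gt0 tsT; rewrite -/(E t) !big_bool.
have [-> +] := space true; have [-> +] := space false; move: time.
move: (derive1 _ _) (barrier _ _ _) (Wt _ _) (E t) (u _ _ _) (u _ _ _).
move: (partials _ _ _) (partials _ _ _) (Wx _ _ _) (Wx _ _ _).
move: (Wxx _ _ _) (Wxx _ _ _) (coord _ _) (coord _ _).
by move=> /= *; lra.
Qed.

(** A positive value of the gap would give a positive maximum on the compact box, which neither the
    boundary nor the interior allows. The barrier stays in the conclusion because [a] depends on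
    [e]; it is for the users to let [e] tend to 0 at a fixed point. *)
Theorem maximum_principle_box x t : s <= t <= T ->
  (forall i, `|coord i x| <= a) -> rho x t <= W x t + barrier e x t.
Proof.
move=> tsT xa; have [/andP[st tT]] := tsT.
suff : gap x t <= 0 by rewrite /gap; lra.
rewrite leNgt; apply/negP => gap0.
pose A : set ((R * R) * R) := (`[- a, a] `*` `[- a, a]) `*` `[s, T].
have AP z : A z <-> s <= z.2 <= T /\ forall i, `|coord i z.1| <= a.
  rewrite /A /= !in_itv/= -!ler_norml; split=> [[[? ?] ?]|[-> za]].
    by split=> //; case.
  by have := za true; have := za false.
have A0 : A !=set0 by exists (x, t); apply/AP.
have cA : compact A.
  by apply: compact_setX; [apply: compact_setX|]; exact: segment_compact.
have [|c /set_mem/AP[csT ca] cmax] :=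
    @compact_EVT_max _ _ (fun z => gap z.1 z.2) A A0 cA.
  have cB := @continuous_subspaceT _ _ A _ (@continuous_barrier e).
  have cr : {within A, continuous (fun z : (R * R) * R => rho z.1 z.2)}.
    apply: continuous_in_subspaceT => z /set_mem/AP[/andP[sz _] _].
    have z0 : 0 < z.2 := lt_le_trans s_gt0 sz.
    have [_ _ _ /(_ [::] isT)] := @rho_regular z.1 _ z0.
    by case: z {sz z0}.
  move=> z; apply: cvgB; last exact: cB.
  by apply: cvgB; [exact: cr|exact: W_continuous].
have gapc : 0 < gap c.1 c.2.
  by rewrite (lt_le_trans gap0)// (cmax (x, t))// inE; apply/AP.
apply: (@gap_no_interior_max c.1 c.2) => //.
- case/andP: csT => sc ->; rewrite andbT lt_neqAle sc andbT.
  apply/eqP => sc2; move: gapc; rewrite ltNge gap_le0_parabolic_boundary//.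
    by rewrite -sc2 lexx (le_trans st).
  by left.
- move=> i; rewrite lt_neqAle ca andbT; apply/eqP => cia.
  by move: gapc; rewrite ltNge gap_le0_parabolic_boundary//; right; exists i.
- by move=> y r rsT ya; apply: (cmax (y, r)); rewrite inE; apply/AP.
Qed.

End comparison.
End maximum_principle.

(** * Heat kernel *)

Lemma bounded_integrable (d : measure_display) (T : measurableType d) (R : realType)
    (mu : {measure set T -> \bar R}) (f g : T -> R) (B : R) :
  mu.-integrable setT (EFin \o f) -> measurable_fun setT g ->
  (forall y, `|g y| <= B) ->
  mu.-integrable setT (EFin \o (fun y => f y * g y)).
Proof.
move=> intf mg gB; have /integrableP[/measurable_EFinP mf _] := intf.
apply: (@le_integrable _ _ _ mu setT measurableT _ (fun y => (B%:E * (f y)%:E)%E)).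
- by apply/measurable_EFinP/measurable_funM.
- move=> y _ /=; rewrite lee_fin !normrM mulrC ler_wpM2r//.
  by rewrite (le_trans (gB y))// ler_norm.
- exact: integrableZl.
Qed.

(** One bound [B] for [F] and [F'] near [a] makes [|f| B] the dominating function, so integrability
    of [f] is all that is asked of the density. *)
Lemma is_derive_under_integral (d : measure_display) (T : measurableType d) (R : realType)
    (mu : {measure set T -> \bar R}) (f : T -> R) (F F' : R -> T -> R)
    (a e B : R) :
  0 < e -> mu.-integrable setT (EFin \o f) ->
  (forall r, measurable_fun setT (F r)) ->
  (forall r y, a - e < r < a + e -> `|F r y| <= B) ->
  (forall r y, a - e < r < a + e -> is_derive r 1 (F ^~ y) (F' r y)) ->
  (forall r y, a - e < r < a + e -> `|F' r y| <= B) ->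
  is_derive a 1 (fun r => \int[mu]_y (f y * F r y))
    (\int[mu]_y (f y * F' a y)).
Proof.
move=> e0 intf mF FB dF F'B.
have Ia : `]a - e, a + e[%classic a.
  by rewrite /= in_itv/=; apply/andP; split; lra.
have int r : `]a - e, a + e[%classic r ->
    mu.-integrable setT (EFin \o (fun y => f y * F r y)).
  rewrite /= in_itv/= => /FB H.
  by apply: (@bounded_integrable _ _ _ mu f (F r) B) => // y; exact: H.
have d1 r y : a - e < r < a + e ->
    is_derive r 1 (fun r => f y * F r y) (f y * F' r y).
  by move=> rae; have h := dF r y rae; exact: is_deriveZ.
have der r y : `]a - e, a + e[%classic r -> [set: T] y ->
    derivable (fun r => f y * F r y) r 1.
  by rewrite /= in_itv/= => /(d1 _ y)[].
have ub r y : `]a - e, a + e[%classic r -> [set: T] y ->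
    `|partial1of2 (fun r y => f y * F r y) r y| <= `|f y| * B.
  rewrite /= in_itv/= => rae _; rewrite partial1of2E.
  by rewrite (@derive_val _ _ _ _ _ _ _ (d1 r y rae)) normrM ler_wpM2l ?F'B.
have B0 y : 0 <= `|f y| * B.
  rewrite mulr_ge0// (le_trans (normr_ge0 (F a y)))// FB//.
have intG : mu.-integrable setT (EFin \o (fun y => `|f y| * B)).
  apply: (@bounded_integrable _ _ _ mu (fun y => `|f y|) (fun _ => B) `|B|) => //.
  exact: integrable_norm.
apply: DeriveDef.
  exact: (@derivable_under_integral _ _ _ mu _ setT measurableT a _ _ Ia int der
    _ B0 intG ub).
rewrite -derive1E (@differentiation_under_integral _ _ _ mu _ setT measurableT a
  _ _ Ia int der _ B0 intG ub).
apply: eq_Rintegral => y _; rewrite partial1of2E.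
apply: (@derive_val _ _ _ _ _ _ _ (d1 a y _)).
by apply/andP; split; lra.
Qed.

Definition heat {R : realType} (tau : R) (z : R * R) : R :=
  (4 * pi * tau)^-1 * expR (- (sqnorm z / (4 * tau))).

Definition heat_x {R : realType} (i : bool) (tau : R) (z : R * R) : R :=
  - (coord i z / (2 * tau)) * heat tau z.

Definition heat_xx {R : realType} (i : bool) (tau : R) (z : R * R) : R :=
  (coord i z ^+ 2 / (4 * tau ^+ 2) - (2 * tau)^-1) * heat tau z.

Definition heat_t {R : realType} (tau : R) (z : R * R) : R :=
  (sqnorm z / (4 * tau ^+ 2) - tau^-1) * heat tau z.

Section heat_kernel.
Variable R : realType.
Implicit Types (tau h : R) (z : R * R) (i : bool).

Lemma pi_neq0 : pi != 0 :> R.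
Proof. by rewrite gt_eqF ?pi_gt0. Qed.

Lemma heat_ge0 tau z : 0 < tau -> 0 <= heat tau z.
Proof.
by move=> t0; rewrite mulr_ge0 ?expR_ge0// invr_ge0 !mulr_ge0 ?pi_ge0// ltW.
Qed.

Lemma heat_equation tau z :
  tau != 0 -> \sum_i heat_xx i tau z = heat_t tau z.
Proof.
by move=> t0; rewrite big_bool /= /heat_xx /heat_t /coord /sqnorm; field.
Qed.

Lemma is_derive_heat_x i tau z :
  tau != 0 -> is_derive z (unit_vec i) (heat tau) (heat_x i tau z).
Proof.
move=> t0; rewrite -[z in is_derive z]addr0 -[in is_derive _](scale0r (unit_vec i)).
apply/is_derive_line.
have dq : is_derive (0 : R) 1 (fun r => sqnorm (z + r *: unit_vec i)) (2 * coord i z).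
  by apply/is_derive_line; rewrite scale0r addr0; exact: is_derive_sqnorm.
have {}dq := is_deriveZ (- (4 * tau)^-1) dq.
have {}dq := is_derive1_comp (is_derive_expR _) dq.
have {}dq := is_deriveZ (4 * pi * tau)^-1 dq.
rewrite (_ : (fun r => _) = (4 * pi * tau)^-1 \*: (expR \o
   (- (4 * tau)^-1 \*: fun r => sqnorm (z + r *: unit_vec i)))).
  apply: (is_derive_eq dq).
  rewrite (_ : (_ \*: _) 0 = - (sqnorm z / (4 * tau))); last first.
    by rewrite /= scale0r addr0 [LHS]mulNr mulrC.
  rewrite /heat_x /heat /GRing.scale/=; move: pi_neq0 (expR _).
  by move: pi => p p0 E; field; rewrite t0 p0.
apply/funext => r; rewrite /heat /=.
by congr (_ * expR _); rewrite [RHS]mulNr mulrC.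
Qed.

Lemma is_derive_heat_xx i tau z :
  tau != 0 -> is_derive z (unit_vec i) (heat_x i tau) (heat_xx i tau z).
Proof.
move=> t0; have h1 := is_derive_heat_x i z t0; have h2 := is_derive_coord i z.
rewrite (_ : heat_x i tau = - (2 * tau)^-1 \*: (coord i * heat tau)).
  apply: is_derive_eq; rewrite /heat_x /heat_xx /GRing.scale/=; field.
  by rewrite t0.
apply/funext => y; rewrite /heat_x fctE/= /GRing.scale/=; field.
by rewrite t0.
Qed.

Lemma is_derive_heat_t tau z :
  tau != 0 -> is_derive tau 1 (heat ^~ z) (heat_t tau z).
Proof.
move=> t0.
have h : is_derive tau 1 (fun r : R => r^-1) (- tau ^- 2).
  apply: is_derive_eq; first exact: is_deriveV.
  by rewrite /GRing.scale/= mulr1.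
rewrite (_ : heat ^~ z = (4 * pi)^-1 \*: ((fun r => r^-1) *
   (expR \o (- (sqnorm z / 4) \*: (fun r => r^-1))))).
  apply: is_derive_eq; rewrite /= /heat_t /heat /GRing.scale/=.
  have -> : - (sqnorm z / (4 * tau)) = - (sqnorm z / 4) * tau^-1 by field.
  move: pi_neq0 (expR _).
  by move: pi => p p0 E; field; rewrite t0 p0.
apply/funext => r; rewrite /heat !fctE/= /GRing.scale/= !invfM.
by rewrite !mulrA mulNr.
Qed.

Lemma xexpRN_le1 h : 0 <= h -> h * expR (- h) <= 1.
Proof.
move=> h0; rewrite expRN ler_pdivrMr ?expR_gt0// mul1r.
by rewrite (le_trans _ (expR_ge1Dx h))//; lra.
Qed.

Lemma heat_le tau z : 0 < tau -> heat tau z <= (4 * pi * tau)^-1.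
Proof.
move=> t0; rewrite ler_piMr//.
  by rewrite invr_ge0 !mulr_ge0 ?pi_ge0// ltW.
by rewrite -expR0 ler_expR oppr_le0 divr_ge0 ?sqnorm_ge0 ?mulr_ge0// ltW.
Qed.

Lemma sqnorm_heat_le tau z : 0 < tau -> sqnorm z * heat tau z <= pi^-1.
Proof.
move=> t0; rewrite /heat.
have -> : sqnorm z * ((4 * pi * tau)^-1 * expR (- (sqnorm z / (4 * tau)))) =
  pi^-1 * (sqnorm z / (4 * tau) * expR (- (sqnorm z / (4 * tau)))).
  move: pi_neq0 (expR _).
  by move: pi => p p0 E; field; rewrite p0 gt_eqF.
rewrite ler_piMr ?invr_ge0 ?pi_ge0// xexpRN_le1//.
by rewrite divr_ge0 ?sqnorm_ge0 ?mulr_ge0// ltW.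
Qed.

Lemma heat_le_inv tau z : 0 < tau -> heat tau z <= tau^-1 / 4.
Proof.
move=> t0; rewrite (le_trans (heat_le z t0))// -!invfM lef_pV2 ?posrE ?mulr_gt0 ?pi_gt0//.
have := @pi_ge2 R; nra.
Qed.

Lemma sqnorm_heat_le_half tau z : 0 < tau -> sqnorm z * heat tau z <= 2^-1.
Proof.
move=> t0; rewrite (le_trans (sqnorm_heat_le z t0))//.
by rewrite lef_pV2 ?posrE ?pi_gt0// pi_ge2.
Qed.

(** This bound and the three similar ones below are crude, but share one constant: it serves both as
    dominating constant under the integral and as Lipschitz constant for times at least [e]. *)
Lemma norm_heat_le e tau z : 0 < e -> e <= tau -> `|heat tau z| <= e^-1 + e ^- 2.
Proof.
move=> e0 et; have t0 := lt_le_trans e0 et.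
rewrite ger0_norm ?heat_ge0// (le_trans (heat_le_inv z t0))//.
have : tau^-1 <= e^-1 by rewrite lef_pV2.
have : 0 <= e ^- 2 by rewrite invr_ge0 sqr_ge0.
have : 0 <= tau^-1 by rewrite invr_ge0 ltW.
lra.
Qed.

Lemma coord_sqr_le i z : coord i z ^+ 2 <= sqnorm z.
Proof. by rewrite (sqnormE z i) lerDl sqr_ge0. Qed.

Lemma norm_heat_x_le e i tau z :
  0 < e -> e <= tau -> `|heat_x i tau z| <= e^-1 + e ^- 2.
Proof.
move=> e0 et; have t0 := lt_le_trans e0 et.
rewrite /heat_x normrM normrN normf_div [X in _ / X]gtr0_norm ?mulr_gt0//.
rewrite [X in _ * X]ger0_norm ?heat_ge0//.
have h0 := heat_ge0 z t0; have h1 := sqnorm_heat_le_half z t0.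
have h2 := heat_le_inv z t0.
have h3 : `|coord i z| * heat tau z <= 4^-1 + tau^-1 / 8.
  have : `|coord i z| <= (1 + sqnorm z) / 2.
    have := coord_sqr_le i z; have := sqr_ge0 (`|coord i z| - 1).
    by rewrite -(real_normK (num_real (coord i z))) !expr2 => *; lra.
  by move=> /(ler_wpM2r h0) h; rewrite (le_trans h)//; lra.
have ti : 0 <= tau^-1 by rewrite invr_ge0 ltW.
have te : tau^-1 <= e^-1 by rewrite lef_pV2.
have -> : `|coord i z| / (2 * tau) * heat tau z =
  tau^-1 / 2 * (`|coord i z| * heat tau z) by rewrite invfM; ring.
have := ler_wpM2l ti h3.
have : tau^-1 * tau^-1 <= e^-1 * e^-1 by rewrite ler_pM.
have : 0 <= tau^-1 * tau^-1 by rewrite mulr_ge0.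
rewrite -exprVn expr2.
by move: te ti; move: (tau^-1) (e^-1) (_ * heat tau z) => a b c *; lra.
Qed.

Lemma norm_heat_t_le e tau z :
  0 < e -> e <= tau -> `|heat_t tau z| <= e^-1 + e ^- 2.
Proof.
move=> e0 et; have t0 := lt_le_trans e0 et.
rewrite /heat_t mulrBl (le_trans (ler_normB _ _))//.
have h0 := heat_ge0 z t0; have h1 := sqnorm_heat_le_half z t0.
have h2 := heat_le_inv z t0.
have ti : 0 <= tau^-1 by rewrite invr_ge0 ltW.
have te : tau^-1 <= e^-1 by rewrite lef_pV2.
have s0 := sqnorm_ge0 z.
have n1 : 0 <= sqnorm z / (4 * tau ^+ 2).
  by apply: divr_ge0 => //; apply: mulr_ge0 => //; exact: sqr_ge0.
rewrite (ger0_norm (mulr_ge0 n1 h0)) (ger0_norm (mulr_ge0 ti h0)).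
have -> : sqnorm z / (4 * tau ^+ 2) * heat tau z =
   (tau^-1 * tau^-1) / 4 * (sqnorm z * heat tau z).
  by field; rewrite gt_eqF.
rewrite -exprVn expr2.
have := ler_wpM2l ti h2.
have : 0 <= tau^-1 * tau^-1 by rewrite mulr_ge0.
have : tau^-1 * tau^-1 <= e^-1 * e^-1 by rewrite ler_pM.
have : 0 <= e^-1 by rewrite invr_ge0 ltW.
move=> h3 h4 h5 h6; have := ler_wpM2l h5 h1; move: ti te h3 h4 h5 h6.
by move: (sqnorm z) (heat tau z) (tau^-1) (e^-1) => *; lra.
Qed.

Lemma norm_heat_xx_le e i tau z :
  0 < e -> e <= tau -> `|heat_xx i tau z| <= e^-1 + e ^- 2.
Proof.
move=> e0 et; have t0 := lt_le_trans e0 et.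
rewrite /heat_xx mulrBl (le_trans (ler_normB _ _))//.
have h0 := heat_ge0 z t0; have h1 := sqnorm_heat_le_half z t0.
have h2 := heat_le_inv z t0.
have ti : 0 <= tau^-1 by rewrite invr_ge0 ltW.
have te : tau^-1 <= e^-1 by rewrite lef_pV2.
have s0 := sqr_ge0 (coord i z).
have n1 : 0 <= coord i z ^+ 2 / (4 * tau ^+ 2).
  by apply: divr_ge0 => //; apply: mulr_ge0 => //; exact: sqr_ge0.
have n2 : 0 <= (2 * tau)^-1 by rewrite invr_ge0 mulr_ge0// ltW.
rewrite (ger0_norm (mulr_ge0 n1 h0)) (ger0_norm (mulr_ge0 n2 h0)).
have -> : coord i z ^+ 2 / (4 * tau ^+ 2) * heat tau z =
   (tau^-1 * tau^-1) / 4 * (coord i z ^+ 2 * heat tau z).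
  by field; rewrite gt_eqF.
have h1' : coord i z ^+ 2 * heat tau z <= 2^-1.
  by rewrite (le_trans _ h1)// ler_wpM2r// coord_sqr_le.
rewrite -exprVn [e^-1 ^+ 2]expr2 invfM.
have := ler_wpM2l ti h2.
have : 0 <= tau^-1 * tau^-1 by rewrite mulr_ge0.
have : tau^-1 * tau^-1 <= e^-1 * e^-1 by rewrite ler_pM.
have : 0 <= e^-1 by rewrite invr_ge0 ltW.
move=> h3 h4 h5 h6; have := ler_wpM2l h5 h1'; move: ti te h3 h4 h5 h6.
by move: (coord i z ^+ 2) (heat tau z) (tau^-1) (e^-1) => *; lra.
Qed.

End heat_kernel.

(** * Mass of the heat kernel and L^1 norm of its gradient *)

Section plane_integrals.
Variable R : realType.
Local Notation mu := (@lebesgue_measure R).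
Local Notation plane := (measurableTypeR R * measurableTypeR R)%type.
Implicit Types (x y z : R * R) (i : bool).

Lemma measurable_coord_sub i (x : R * R) :
  measurable_fun [set: plane] (fun y : plane => coord i (x - y)).
Proof.
by case: i => /=; apply: measurable_funB.
Qed.

Lemma measurable_sqnorm_sub (x : R * R) :
  measurable_fun [set: plane] (fun y : plane => sqnorm (x - y)).
Proof.
rewrite (_ : (fun y => _) =
  fun y : plane => coord false (x - y) ^+ 2 + coord true (x - y) ^+ 2) //.
by apply: measurable_funD; apply: measurable_funX; exact: measurable_coord_sub.
Qed.

Lemma measurable_heat_sub tau x :
  measurable_fun [set: plane] (fun y : plane => heat tau (x - y)).
Proof.
apply: measurable_funM => //; apply: measurableT_comp => //.
apply: measurable_funN; apply: measurable_funM => //.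
exact: measurable_sqnorm_sub.
Qed.

Lemma measurable_heat_x_sub i tau x :
  measurable_fun [set: plane] (fun y : plane => heat_x i tau (x - y)).
Proof.
apply: measurable_funM; last exact: measurable_heat_sub.
apply: measurable_funN; apply: measurable_funM => //.
exact: measurable_coord_sub.
Qed.

Lemma measurable_heat_xx_sub i tau x :
  measurable_fun [set: plane] (fun y : plane => heat_xx i tau (x - y)).
Proof.
apply: measurable_funM; last exact: measurable_heat_sub.
apply: measurable_funB => //; apply: measurable_funM => //.
by apply: measurable_funX; exact: measurable_coord_sub.
Qed.

Lemma measurable_heat_t_sub tau x :
  measurable_fun [set: plane] (fun y : plane => heat_t tau (x - y)).
Proof.
apply: measurable_funM; last exact: measurable_heat_sub.
apply: measurable_funB => //; apply: measurable_funM => //.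
exact: measurable_sqnorm_sub.
Qed.

Lemma integral_leb2_prod (f g : R -> R) :
  measurable_fun setT f -> measurable_fun setT g ->
  (forall r, 0 <= f r) -> (forall r, 0 <= g r) ->
  (\int[leb2]_y (f y.1 * g y.2)%:E =
   (\int[mu]_r (f r)%:E) * (\int[mu]_r (g r)%:E))%E.
Proof.
move=> mf mg f0 g0.
rewrite (fubini_tonelli1 (fun y : plane => (f y.1 * g y.2)%:E)); last 2 first.
- apply/measurable_EFinP; apply: measurable_funM; apply: measurableT_comp => //.
- by move=> y; rewrite lee_fin mulr_ge0.
rewrite /fubini_F /=.
transitivity (\int[mu]_r ((f r)%:E * \int[mu]_r (g r)%:E))%E.
  apply: eq_integral => r _; under eq_integral do rewrite EFinM.
  apply: ge0_integralZl; rewrite ?lee_fin//; first exact/measurable_EFinP.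
  by move=> s _; rewrite lee_fin.
apply: ge0_integralZr => //.
- exact/measurable_EFinP.
- by move=> r _; rewrite lee_fin.
- by apply: integral_ge0 => r _; rewrite lee_fin.
Qed.

(** The one-dimensional heat kernel centred at [m], which is the normal density of variance 2 tau;
    the plane kernel is a product of two of them. *)
Definition heat1 (tau m r : R) : R :=
  (Num.sqrt (4 * pi * tau))^-1 * expR (- ((m - r) ^+ 2 / (4 * tau))).

Lemma heat_heat1 tau x y : 0 < tau ->
  heat tau (x - y) = heat1 tau x.1 y.1 * heat1 tau x.2 y.2.
Proof.
move=> t0; rewrite /heat /heat1 mulrACA -expRD -invfM -expr2 sqr_sqrtr.
  by rewrite -opprD -mulrDl.
by rewrite !mulr_ge0 ?pi_ge0// ltW.
Qed.

Lemma heat1_ge0 tau m r : 0 <= heat1 tau m r.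
Proof. by rewrite mulr_ge0 ?expR_ge0 ?invr_ge0 ?sqrtr_ge0. Qed.

Lemma heat1E tau m r : 0 < tau ->
  heat1 tau m r = normal_pdf m (Num.sqrt (2 * tau)) r.
Proof.
move=> t0; rewrite normal_pdfE; last by rewrite sqrtr_eq0 -ltNge mulr_gt0.
rewrite /normal_peak /normal_fun sqr_sqrtr ?mulr_ge0 ?(ltW t0)// /heat1.
congr (_^-1 * expR _); first by congr (Num.sqrt _); rewrite mulr2n; ring.
rewrite -mulNr -sqrrN opprB mulr2n; congr (_ / _); ring.
Qed.

Lemma measurable_heat1 tau m : measurable_fun setT (heat1 tau m).
Proof.
apply: measurable_funM => //; apply: measurableT_comp => //.
apply: measurable_funN; apply: measurable_funM => //.
by apply: measurable_funX; apply: measurable_funB.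
Qed.

Lemma integral_heat1 tau m : 0 < tau -> (\int[mu]_r (heat1 tau m r)%:E = 1)%E.
Proof.
move=> t0; under eq_integral do rewrite heat1E//.
by rewrite integral_normal_pdf.
Qed.

Lemma integral_heat tau x : 0 < tau ->
  (\int[leb2]_y (heat tau (x - y))%:E = 1)%E.
Proof.
move=> t0; under eq_integral do rewrite heat_heat1//.
rewrite (@integral_leb2_prod (heat1 tau x.1) (heat1 tau x.2)).
- by rewrite !integral_heat1// mule1.
- exact: measurable_heat1.
- exact: measurable_heat1.
- by move=> r; exact: heat1_ge0.
- by move=> r; exact: heat1_ge0.
Qed.

Lemma is_derive_heat1 (tau r : R) : 0 < tau ->
  is_derive r 1 (heat1 tau 0) (- (r / (2 * tau)) * heat1 tau 0 r).
Proof.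
move=> t0.
have dq : is_derive r 1 (fun s : R => (- (4 * tau)^-1) * (s * s))
    (- (4 * tau)^-1 * (2 * r)).
  by apply: is_derive_eq; rewrite /GRing.scale/= !mulr1; congr (_ * _); ring.
have {}dq := is_derive1_comp (is_derive_expR _) dq.
have {}dq := is_deriveZ (Num.sqrt (4 * pi * tau))^-1 dq.
rewrite (_ : heat1 tau 0 = (Num.sqrt (4 * pi * tau))^-1 \*: (expR \o
   (fun s : R => (- (4 * tau)^-1) * (s * s)))).
  apply: (is_derive_eq dq) => /=; rewrite /GRing.scale/=.
  by move: (expR _) (Num.sqrt _)^-1 => E q; field; rewrite gt_eqF.
apply/funext => s; rewrite /heat1 /= sub0r sqrrN expr2 mulNr mulrC.
by rewrite [RHS]mulrC [_ * (s * s)]mulrC.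
Qed.

Lemma continuous_heat1 (tau : R) : 0 < tau -> continuous (heat1 tau 0).
Proof.
move=> t0 r; apply: differentiable_continuous.
by apply/derivable1_diffP; have [] := is_derive_heat1 r t0.
Qed.

Lemma cvg_heat1 (tau : R) : 0 < tau -> heat1 tau 0 r @[r --> +oo] --> 0.
Proof.
move=> t0; rewrite -[X in _ --> X](mulr0 (Num.sqrt (4 * pi * tau))^-1).
apply: cvgM; first exact: cvg_cst.
apply: (@cvg_comp _ _ _ (fun r : R => (0 - r) ^+ 2 / (4 * tau)) (fun q => expR (- q)) _ +oo);
  last exact: cvgr_expR.
apply/cvgryPge => A; near=> r.
rewrite sub0r sqrrN ler_pdivlMr ?mulr_gt0//.
have r1 : 1 <= r by near: r; apply: nbhs_pinfty_ge; rewrite num_real.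
have rA : A * (4 * tau) <= r by near: r; apply: nbhs_pinfty_ge; rewrite num_real.
by rewrite (le_trans rA)// expr2 ler_peMl// (le_trans ler01).
Unshelve. all: by end_near. Qed.

(** On the half-line the integrand is minus the derivative of [heat1 tau 0], so the integral is the
    value of the kernel at its centre. *)
Lemma integral_first_moment_heat1_pos (tau : R) : 0 < tau ->
  (\int[mu]_(r in [set r | (0 <= r)%R]) (`|r| / (2 * tau) * heat1 tau 0 r)%:E =
   ((Num.sqrt (4 * pi * tau))^-1)%:E)%E.
Proof.
move=> t0.
have cf : continuous (fun r : R => r / (2 * tau) * heat1 tau 0 r).
  move=> r; apply: cvgM; last exact: continuous_heat1.
  by apply: cvgM; [exact: cvg_id|exact: cvg_cst].
rewrite -set_itvcy.
under eq_integral.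
  by move=> r; rewrite inE/= in_itv/= andbT => r0; rewrite ger0_norm//; over.
rewrite (@ge0_continuous_FTC2y _ _ (fun r => - heat1 tau 0 r) 0 0).
- rewrite sub0e -EFinN opprK /heat1 subr0 expr0n mul0r oppr0 expR0 mulr1.
  by [].
- by move=> r r0; rewrite mulr_ge0 ?heat1_ge0// divr_ge0// mulr_ge0// ltW.
- exact: continuous_subspaceT.
- by rewrite -[X in _ --> X]oppr0; apply: cvgN; exact: cvg_heat1.
- move=> r _; have h := is_derive_heat1 r t0.
  by apply: derivableN; case: h.
- by apply: cvgN; apply: cvg_at_right_filter; exact: continuous_heat1.
- move=> r _; have h := is_derive_heat1 r t0.
  rewrite derive1E.
  have /(@derive_val _ _ _ _ _ _ _) -> : is_derive r 1 (fun r => - heat1 tau 0 r)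
     (- (- (r / (2 * tau)) * heat1 tau 0 r)) by exact: is_deriveN.
  by rewrite mulNr opprK.
Qed.

(** After translation to [m = 0] the integrand is even, and twice 1 / sqrt (4 pi tau) is 1 / sqrt
    (pi tau). *)
Lemma integral_first_moment_heat1 (tau m : R) : 0 < tau ->
  (\int[mu]_r (`|m - r| / (2 * tau) * heat1 tau m r)%:E =
   ((Num.sqrt (pi * tau))^-1)%:E)%E.
Proof.
move=> t0.
pose G r := `|r| / (2 * tau) * heat1 tau 0 r.
have cG : continuous G.
  move=> r; apply: cvgM; last exact: continuous_heat1.
  by apply: cvgM; [exact: norm_continuous|exact: cvg_cst].
have G0 r : 0 <= G r.
  by rewrite mulr_ge0 ?heat1_ge0// divr_ge0// mulr_ge0// ltW.
pose F (r : R) := r - m.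
have dF (r : R) : is_derive r 1 F 1.
  by apply: is_derive_eq; rewrite subr0.
have F'E : derive1 F = cst 1.
  by apply/funext => r; rewrite derive1E; exact: (@derive_val _ _ _ _ _ _ _ (dF r)).
(* The factor [derive1 F] is the constant 1; it gives the integrand the shape required by the change
   of variables. *)
transitivity (\int[mu]_r (((G \o F) * derive1 F) r)%:E)%E.
  apply: eq_integral => r _; congr EFin; rewrite F'E /= /GRing.mul/= mulr1.
  by rewrite /G /F distrC /heat1 sub0r opprB.
rewrite -increasing_ge0_integration_by_substitutionT//.
- rewrite ge0_symfun_integralT//.
    rewrite integral_first_moment_heat1_pos// -EFinM; congr EFin.
    rewrite -mulrA sqrtrM// (_ : (4 : R) = 2 ^+ 2); last by rewrite -natrX.
    by rewrite sqrtr_sqr ger0_norm// invfM mulrA divff// mul1r.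
  by move=> r; rewrite /G/= normrN /heat1 !sub0r !sqrrN.
- by move=> x y xy; rewrite ltrD2r.
- by rewrite F'E; exact: cst_continuous.
- by rewrite F'E; exact: is_cvg_cst.
- by rewrite F'E; exact: is_cvg_cst.
- apply/cvgrNyPle => A; near=> r.
  by rewrite lerBlDr; near: r; apply: nbhs_ninfty_le; rewrite num_real.
- apply/cvgryPge => A; near=> r.
  by rewrite lerBrDr; near: r; apply: nbhs_pinfty_ge; rewrite num_real.
Unshelve. all: by end_near. Qed.

(** The kernel factorizes: the coordinate [i] contributes the first moment, the other one the mass
    1. *)
Lemma integral_norm_heat_x i tau x : 0 < tau ->
  (\int[leb2]_y `|heat_x i tau (x - y)|%:E = ((Num.sqrt (pi * tau))^-1)%:E)%E.
Proof.
move=> t0.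
have E y : `|heat_x i tau (x - y)| =
    `|coord i x - coord i y| / (2 * tau) * heat tau (x - y).
  rewrite /heat_x normrM normrN normf_div (@ger0_norm _ (heat _ _)) ?heat_ge0//.
  rewrite (@gtr0_norm _ (2 * tau)) ?mulr_gt0//; congr (`|_| / _ * _).
  by rewrite /coord; case: (i).
have m1 (m : R) : measurable_fun setT (fun r : R => `|m - r| / (2 * tau) * heat1 tau m r).
  apply: measurable_funM; last exact: measurable_heat1.
  apply: measurable_funM => //; apply: measurableT_comp => //.
  exact: measurable_funB.
have p1 (m r : R) : 0 <= `|m - r| / (2 * tau) * heat1 tau m r.
  by rewrite mulr_ge0 ?heat1_ge0// divr_ge0// mulr_ge0// ltW.
under eq_integral do rewrite E heat_heat1//.
case: i {E} => /=.
- under eq_integral do rewrite mulrCA.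
  rewrite (@integral_leb2_prod (heat1 tau x.1)
    (fun r => `|x.2 - r| / (2 * tau) * heat1 tau x.2 r))//.
  + by rewrite integral_heat1// mul1e integral_first_moment_heat1.
  + exact: measurable_heat1.
  + by move=> r; exact: heat1_ge0.
- under eq_integral do rewrite mulrA.
  rewrite (@integral_leb2_prod
    (fun r => `|x.1 - r| / (2 * tau) * heat1 tau x.1 r) (heat1 tau x.2))//.
  + by rewrite integral_heat1// mule1 integral_first_moment_heat1.
  + exact: measurable_heat1.
  + by move=> r; exact: heat1_ge0.
Qed.

End plane_integrals.

(** * Velocity bound *)

Lemma norm_Rintegral_le (d : measure_display) (T : measurableType d) (R : realType)
    (mu : {measure set T -> \bar R}) (f h : T -> R) (c : R) :
  measurable_fun setT f -> measurable_fun setT h ->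
  (forall y, `|f y| <= h y) -> (\int[mu]_y (h y)%:E <= c%:E)%E ->
  mu.-integrable setT (EFin \o f) /\ `|\int[mu]_y f y| <= c.
Proof.
move=> mf mh fh hc.
have h0 y : 0 <= h y := le_trans (normr_ge0 _) (fh y).
have inth : mu.-integrable setT (EFin \o h).
  apply/integrableP; split; first exact/measurable_EFinP.
  under eq_integral do rewrite /= ger0_norm//.
  by rewrite (le_lt_trans hc) ?ltry.
have intf : mu.-integrable setT (EFin \o f).
  apply: (le_integrable measurableT) inth; first exact/measurable_EFinP.
  by move=> y _ /=; rewrite lee_fin (ger0_norm (h0 y)).
split=> //; rewrite (le_trans (le_normr_Rintegral measurableT intf))//.
apply: (@le_trans _ _ (\int[mu]_y h y)).
  by apply: le_Rintegral => //; exact: integrable_norm.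
rewrite /Rintegral -lee_fin fineK//.
exact: integrable_fin_num inth.
Qed.

Lemma measurable_invr (R : realType) : measurable_fun [set: R] (fun r : R => r^-1).
Proof.
rewrite -(setvU [set 0]); apply/measurable_funU => //.
  exact: measurableC.
split; last exact: measurable_fun_set1.
apply: open_continuous_measurable_fun.
  by apply: closed_openC; exact: closed_eq.
by move=> r; rewrite inE /= => /eqP r0; exact: inv_continuous.
Qed.

Section velocity_bound.
Variable R : realType.
Local Notation mu := (@lebesgue_measure R).
Local Notation plane := (measurableTypeR R * measurableTypeR R)%type.
Implicit Types (x y z : R * R) (i : bool).

(** The balls of this norm are squares, so their areas come from products of intervals and no polar
    coordinates are needed to integrate 1 / |z|. *)
Definition maxnorm z : R := Num.max `|z.1| `|z.2|.

Lemma maxnorm_ge0 z : 0 <= maxnorm z.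
Proof. by rewrite le_max normr_ge0. Qed.

Lemma measurable_maxnorm_sub x :
  measurable_fun [set: plane] (fun y : plane => maxnorm (x - y)).
Proof.
apply: measurable_maxr; apply: measurableT_comp => //; exact: measurable_funB.
Qed.

(* (1 + s) / (1 + s^2) <= 5 / 4, with s the ratio of the two coordinates. *)
Lemma norm_biot_savart_le z :
  \sum_(i : bool) `|biot_savart i z| <= (2 * pi)^-1 * (5 / 4) * (maxnorm z)^-1.
Proof.
have p0 : 0 <= (2 * pi)^-1 :> R by rewrite invr_ge0 mulr_ge0 ?pi_ge0.
rewrite big_bool /= /biot_savart !normrM (ger0_norm p0) -mulrDr -mulrA ler_wpM2l//.
rewrite normrN -mulrDl normfV (ger0_norm (sqnorm_ge0 _)).
have [z0|zn0] := eqVneq (sqnorm z) 0.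
  by rewrite z0 invr0 mulr0 mulr_ge0// invr_ge0 maxnorm_ge0.
have sz0 : 0 < sqnorm z by rewrite lt_def zn0 sqnorm_ge0.
have m0 : 0 < maxnorm z.
  rewrite lt_def maxnorm_ge0 andbT; apply: contra_neq zn0 => m0.
  have : `|z.1| <= maxnorm z by rewrite le_max lexx.
  have : `|z.2| <= maxnorm z by rewrite le_max lexx orbT.
  by rewrite m0 !normr_le0 /sqnorm => /eqP -> /eqP ->; rewrite expr0n addr0.
rewrite ler_pdivrMr// mulrAC ler_pdivlMr// /sqnorm.
rewrite -(real_normK (num_real z.1)) -(real_normK (num_real z.2)) /maxnorm.
move: (normr_ge0 z.1) (normr_ge0 z.2); move: `|z.1| `|z.2| => a b a0 b0.
have [ab|ba] := leP a b.
- have := sqr_ge0 (2 * a - b); rewrite !expr2 => h; nra.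
- have := sqr_ge0 (2 * b - a); rewrite !expr2 => h; nra.
Qed.

(** A layer-cake decomposition: with n = [maxnorm (x - y)], 1/n is 1/r plus the integral of s^(-2)
    over [n, r]. Integrating in [y] first replaces the singularity by areas of squares. *)
Let slice (x : R * R) (r : R) (y : plane) (s : R) : R :=
  s ^- 2 * ((maxnorm (x - y) <= s <= r)%R : bool)%:R.

Let slice_ge0 x r y s : 0 <= slice x r y s.
Proof. by rewrite mulr_ge0// invr_ge0 sqr_ge0. Qed.

Let measurable_natr_bool (d : measure_display) (T : measurableType d)
  (b : T -> bool) : measurable_fun setT b ->
  measurable_fun setT (fun t => (b t)%:R : R).
Proof.
move=> mb; rewrite (_ : (fun t => _) = (fun t => if b t then 1 else 0)); last first.
  by apply/funext => t; case: (b t).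
exact: measurable_fun_ifT.
Qed.

Let measurable_slice x r :
  measurable_fun setT (fun w : plane * measurableTypeR R => slice x r w.1 w.2).
Proof.
apply: measurable_funM; last apply: measurable_natr_bool.
  rewrite (_ : (fun w => _) = (fun s : measurableTypeR R => s ^- 2) \o snd)//.
  apply: measurableT_comp => //.
  apply: (@measurableT_comp _ _ _ _ _ _ (fun s : R => s^-1)); last exact: measurable_funX.
  exact: measurable_invr.
apply: measurable_and.
  apply: measurable_fun_ler => //.
  rewrite (_ : (fun w => _) = (fun y : plane => maxnorm (x - y)) \o fst)//.
  by apply: measurableT_comp => //; exact: measurable_maxnorm_sub.
exact: measurable_fun_ler.
Qed.

Let integral_norm_le m s : 0 <= s ->
  (\int[mu]_r ((`|m - r| <= s)%R : bool)%:R%:E = (2 * s)%:E)%E.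
Proof.
move=> s0.
transitivity (\int[mu]_r (\1_(`[m - s, m + s]%classic) r)%:E)%E.
  apply: eq_integral => r _; rewrite indicE mem_setE in_itv/=.
  by rewrite distrC ler_distl.
rewrite integral_indic//= setIT.
have -> := @lebesgue_measure_itv R `[m - s, m + s]; rewrite /= lte_fin.
case: ltP => [_|]; first by rewrite -EFinB; congr EFin; lra.
by move=> h; congr EFin; lra.
Qed.

Let integral_slice_plane x r s :
  (\int[leb2]_y (slice x r y s)%:E <= (4 * ((0 <= s <= r)%R : bool)%:R)%:E)%E.
Proof.
have [/andP[s0 sr]|nsr] := boolP (0 <= s <= r)%R; last first.
  rewrite mulr0 integral0_eq// => y _; rewrite /slice.
  case: andP => [[ms sr]|]; last by rewrite mulr0.
  by move: nsr; rewrite sr (le_trans (maxnorm_ge0 _) ms).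
rewrite mulr1.
have E y : slice x r y s = s ^- 2 * ((`|x.1 - y.1| <= s)%R : bool)%:R
    * ((`|x.2 - y.2| <= s)%R : bool)%:R.
  rewrite /slice sr andbT /maxnorm ge_max /= -mulrA; congr (_ * _).
  by case: (_ <= s); case: (_ <= s); rewrite /= ?mulr1 ?mulr0.
under eq_integral do rewrite E.
have mb (m : R) : measurable_fun [set: R] (fun r => ((`|m - r| <= s)%R : bool)%:R : R).
  apply: measurable_natr_bool; apply: measurable_fun_ler => //.
  by apply: measurableT_comp => //; exact: measurable_funB.
rewrite (@integral_leb2_prod _ (fun a => s ^- 2 * ((`|x.1 - a| <= s)%R : bool)%:R)
  (fun a => ((`|x.2 - a| <= s)%R : bool)%:R)).
- under eq_integral do rewrite EFinM.
  rewrite ge0_integralZl//; last 2 first.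
    by apply/measurable_EFinP; exact: mb.
    by rewrite lee_fin invr_ge0 sqr_ge0.
  rewrite !integral_norm_le// -!EFinM lee_fin.
  (* The square has area (2 s)^2, which cancels [s ^- 2] up to the factor 4; at [s = 0] the
     convention 0^-1 = 0 gives 0, hence only an inequality. *)
  have [->|sn0] := eqVneq s 0; first by rewrite !mulr0.
  by rewrite le_eqVlt; apply/orP; left; apply/eqP; field.
- by apply: measurable_funM => //; exact: mb.
- exact: mb.
- by move=> a; rewrite mulr_ge0// invr_ge0 sqr_ge0.
- by [].
Qed.

(** If n < r this is the fundamental theorem of calculus for -1/s on [n, r]; otherwise 1/n <= 1/r
    already. *)
Let integral_slice_line x r y : 0 < r -> 0 < maxnorm (x - y) ->
  (((maxnorm (x - y))^-1)%:E <= (r^-1)%:E + \int[mu]_s (slice x r y s)%:E)%E.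
Proof.
move=> r0 n0; set n := maxnorm (x - y) in n0 *.
have [rn|nr] := leP r n.
  rewrite -[leLHS]adde0 leeD//; last by apply: integral_ge0 => s _; rewrite lee_fin.
  by rewrite lee_fin lef_pV2.
rewrite (_ : (\int[mu]_s _ = \int[mu]_(s in `[n, r]) (s ^- 2)%:E)%E); last first.
  rewrite [RHS]integral_mkcond; apply: eq_integral => s _.
  rewrite patchE mem_setE in_itv/= /slice -/n.
  by case: ifP => _; rewrite ?mulr1 ?mulr0.
have dV s : n <= s -> is_derive s 1 (fun s : R => - s^-1) (s ^- 2).
  move=> ns; have s0 : s != 0 by rewrite gt_eqF// (lt_le_trans n0).
  have h := is_deriveV s0 (is_derive_id s 1).
  by apply: (is_derive_eq (is_deriveN h)); rewrite scaleNr opprK [LHS]mulr1.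
have cV s : n <= s -> {for s, continuous (fun s : R => s^-1)}.
  by move=> ns; apply: inv_continuous; rewrite gt_eqF// (lt_le_trans n0).
rewrite (@continuous_FTC2 _ _ (fun s => - s^-1))//.
- by rewrite -EFinB -EFinD lee_fin; lra.
- apply: continuous_in_subspaceT => s; rewrite inE/= in_itv/= => /andP[ns _].
  rewrite (_ : (fun s : R => s ^- 2) = fun s => s^-1 * s^-1); last first.
    by apply/funext => q; rewrite -exprVn expr2.
  by apply: cvgM; exact: cV.
- split.
  + by move=> s; rewrite in_itv/= => /andP[/ltW ns _]; case: (dV s ns).
  + by apply: cvgN; apply: cvg_at_right_filter; exact: cV.
  + by apply: cvgN; apply: cvg_at_left_filter; apply: cV; exact: ltW.
- move=> s; rewrite in_itv/= => /andP[/ltW ns _].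
  by rewrite derive1E (@derive_val _ _ _ _ _ _ _ (dV s ns)).
Qed.

Lemma sigma_finite_leb2 : sigma_finite [set: plane] (@leb2 R).
Proof.
exists (fun n => `[- n%:R, n%:R]%classic `*` `[- n%:R, n%:R]%classic).
  rewrite predeqE => y; split=> // _.
  exists (Num.bound (maxnorm y)) => //=.
  have /ltW : maxnorm y < (Num.bound (maxnorm y))%:R.
    by apply: archi_boundP; exact: maxnorm_ge0.
  by rewrite ge_max !in_itv/= -!ler_norml => /andP[-> ->].
move=> n; split; first exact: measurableX.
rewrite /leb2 /= product_measure1E//=.
by rewrite !lebesgue_measure_itv/=; case: ifP => _; rewrite ?mule0 ?ltry// -EFinM ltry.
Qed.
(** Tonelli's theorem between the plane (variable [y]) and the line (variable [s]) requires the
    plane measure bundled as a sigma-finite one. *)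
Definition leb2_sigma_finite : {sigma_finite_measure set plane -> \bar R} :=
  HB.pack_for {sigma_finite_measure set plane -> \bar R}
    (@product_measure1 _ _ _ _ R mu mu)
    (Measure_isSigmaFinite.Build _ _ _ (@product_measure1 _ _ _ _ R mu mu)
       sigma_finite_leb2).

Section bounded_density.
Variables (f : R * R -> R) (m : R).
Hypothesis mf : measurable_fun [set: plane] f.
Hypothesis f_ge0 : forall y, 0 <= f y.
Hypothesis f_le : forall y, f y <= m.
Hypothesis f_int : (\int[leb2]_y (f y)%:E <= 1)%E.

(** The far part 1/r is paired with the mass of [f], the slices within distance [r] with its upper
    bound [m]; each slice contributes 4 for [s] in [0, r]. *)
Lemma integral_inv_maxnorm_le x r : 0 < r ->
  (\int[leb2]_y (f y * (maxnorm (x - y))^-1)%:E <= (r^-1 + 4 * m * r)%:E)%E.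
Proof.
move=> r0.
have m0 : 0 <= m := le_trans (f_ge0 x) (f_le x).
have line_ge0 y : (0 <= \int[mu]_s (slice x r y s)%:E)%E.
  by apply: integral_ge0 => s _; rewrite lee_fin.
have mslice : measurable_fun setT
    (fun w : plane * measurableTypeR R => (slice x r w.1 w.2)%:E).
  by apply/measurable_EFinP; exact: measurable_slice.
have mline : measurable_fun [set: plane] (fun y => \int[mu]_s (slice x r y s)%:E)%E.
  apply: (measurable_fun_fubini_tonelli_F
    (fun w : plane * measurableTypeR R => (slice x r w.1 w.2)%:E)) => // w.
  by rewrite lee_fin.
have int_line : (\int[leb2]_y \int[mu]_s (slice x r y s)%:E <= (4 * r)%:E)%E.
  have -> : (\int[leb2]_y \int[mu]_s (slice x r y s)%:E =
      \int[mu]_s \int[leb2]_y (slice x r y s)%:E)%E.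
    have H := @fubini_tonelli _ _ _ _ _ leb2_sigma_finite mu
      (fun w : plane * measurableTypeR R => (slice x r w.1 w.2)%:E) mslice.
    by apply: H => w; rewrite lee_fin.
  apply: (@le_trans _ _ (\int[mu]_s (4 * ((0 <= s <= r)%R : bool)%:R)%:E)%E).
    apply: ge0_le_integral => //.
    + by move=> s _; apply: integral_ge0 => y _; rewrite lee_fin.
    + have H := @measurable_fun_fubini_tonelli_G _ _ _ _ _ leb2_sigma_finite
        (fun w : plane * measurableTypeR R => (slice x r w.1 w.2)%:E) mslice.
      by apply: H => w; rewrite lee_fin.
    + apply/measurable_EFinP; apply: measurable_funM => //.
      by apply: measurable_natr_bool; apply: measurable_and;
        exact: measurable_fun_ler.
  rewrite (_ : (\int[mu]_s _ = \int[mu]_(s in `[0%R, r]) 4%:E)%E); last first.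
    rewrite [RHS]integral_mkcond; apply: eq_integral => s _.
    rewrite patchE mem_setE in_itv/=.
    by case: ifP => _; rewrite ?mulr1 ?mulr0.
  rewrite integral_cst//=.
  have -> := @lebesgue_measure_itv R `[0, r]; rewrite /= lte_fin r0.
  by rewrite -EFinB subr0 -EFinM.
apply: (@le_trans _ _ (\int[leb2]_y ((f y * r^-1)%:E +
    m%:E * \int[mu]_s (slice x r y s)%:E))%E).
  apply: ge0_le_integral => //.
  - by move=> y _; rewrite lee_fin mulr_ge0// invr_ge0 maxnorm_ge0.
  - apply/measurable_EFinP; apply: measurable_funM => //.
    apply: (@measurableT_comp _ _ _ _ _ _ (fun s : R => s^-1)).
      exact: measurable_invr.
    exact: measurable_maxnorm_sub.
  - apply: emeasurable_funD.
      by apply/measurable_EFinP; exact: measurable_funM.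
    exact: measurable_funeM.
  (* At [y = x] the left side is 0, by the convention 0^-1 = 0. *)
  - move=> y _; have [n0|n0] := ltP 0 (maxnorm (x - y)); last first.
      have -> : maxnorm (x - y) = 0 by apply/eqP; rewrite eq_le n0 maxnorm_ge0.
      rewrite invr0 mulr0 adde_ge0 ?mule_ge0 ?lee_fin ?mulr_ge0 ?invr_ge0//.
      exact: ltW.
    rewrite EFinM (le_trans (lee_wpmul2l _ (integral_slice_line r0 n0))) ?lee_fin//.
    rewrite ge0_muleDr ?lee_fin ?invr_ge0 ?(ltW r0)// EFinM leeD2l//.
    by rewrite lee_wpmul2r// lee_fin.
rewrite ge0_integralD//; last 4 first.
- by move=> y _; rewrite lee_fin mulr_ge0// invr_ge0 ltW.
- by apply/measurable_EFinP; exact: measurable_funM.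
- by move=> y _; rewrite mule_ge0// lee_fin.
- exact: measurable_funeM.
rewrite EFinD leeD//.
- under eq_integral do rewrite EFinM.
  rewrite ge0_integralZr//.
  + rewrite -[leRHS]mul1e lee_wpmul2r// lee_fin invr_ge0 ltW//.
  + exact/measurable_EFinP.
  + by move=> y _; rewrite lee_fin.
  + by rewrite lee_fin invr_ge0 ltW.
- rewrite ge0_integralZl ?lee_fin//.
  rewrite mulrC mulrA EFinM [leRHS]muleC mulrC lee_wpmul2l ?lee_fin//.
Qed.

Lemma velocity_le x : 0 < m ->
  \sum_(i : bool) `|velocity f i x| <= 5 / (2 * pi) * Num.sqrt m.
Proof.
move=> m0; have sm0 : 0 < Num.sqrt m by rewrite sqrtr_gt0.
pose c : R := (2 * pi)^-1 * (5 / 4).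
have c0 : 0 <= c by rewrite mulr_ge0 ?invr_ge0 ?mulr_ge0 ?pi_ge0.
pose h (y : plane) := c * (f y * (maxnorm (x - y))^-1).
have mh0 : measurable_fun [set: plane] (fun y => f y * (maxnorm (x - y))^-1).
  apply: measurable_funM => //.
  apply: (@measurableT_comp _ _ _ _ _ _ (fun s : R => s^-1)).
    exact: measurable_invr.
  exact: measurable_maxnorm_sub.
have mh : measurable_fun setT h by exact: measurable_funM.
have inth : (\int[leb2]_y (h y)%:E <= (5 / (2 * pi) * Num.sqrt m)%:E)%E.
  under eq_integral do rewrite EFinM.
  rewrite ge0_integralZl ?lee_fin//; last 2 first.
    exact/measurable_EFinP.
    by move=> y _; rewrite lee_fin mulr_ge0// invr_ge0 maxnorm_ge0.
  (* This radius minimizes r^-1 + 4 m r: both terms equal 2 sqrt m, and 4 sqrt m times the kernel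
     constant 5 / (8 pi) is the claimed bound. *)
  have r0 : 0 < (2 * Num.sqrt m)^-1 by rewrite invr_gt0 mulr_gt0.
  apply: (le_trans (lee_wpmul2l _ (integral_inv_maxnorm_le x r0))).
    by rewrite lee_fin.
  rewrite -EFinM lee_fin le_eqVlt; apply/orP; left; apply/eqP.
  rewrite /c -[X in 4 * X](sqr_sqrtr (ltW m0)); move: (Num.sqrt m) sm0 => q q0.
  have := @pi_neq0 R; move: pi => p p0.
  by field; rewrite p0 gt_eqF.
pose K i (y : plane) := biot_savart i (x - y) * f y.
have mK i : measurable_fun setT (K i).
  apply: measurable_funM => //; apply: measurable_funM => //.
  apply: measurable_funM; first case: i => /=.
  - exact: (@measurable_coord_sub R false).
  - by apply: measurable_funN; exact: (@measurable_coord_sub R true).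
  - apply: (@measurableT_comp _ _ _ _ _ _ (fun s : R => s^-1)).
      exact: measurable_invr.
    exact: measurable_sqnorm_sub.
have sumK y : `|K true y| + `|K false y| <= h y.
  rewrite /K /h (normrM (biot_savart true _)) (normrM (biot_savart false _)).
  rewrite (ger0_norm (f_ge0 y)) -mulrDl.
  rewrite [leRHS]mulrCA [leLHS]mulrC ler_wpM2l//.
  by have := norm_biot_savart_le (x - y); rewrite big_bool.
have intK i : leb2.-integrable setT (EFin \o K i).
  have [|//] := @norm_Rintegral_le _ _ _ leb2 (K i) h _ (mK i) mh _ inth.
  move=> y; rewrite (le_trans _ (sumK y))//.
  by case: (i); rewrite ?lerDl ?lerDr.
have intnK i : leb2.-integrable setT (EFin \o (fun y => `|K i y|)).
  exact: integrable_norm.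
rewrite big_bool /=.
(* The components are added under the integral, since the constant 5/4 bounds their pointwise
   sum. *)
apply: (@le_trans _ _ (\int[leb2]_y (`|K true y| + `|K false y|))).
  rewrite RintegralD//; apply: lerD.
    exact: (le_normr_Rintegral measurableT (intK true)).
  exact: (le_normr_Rintegral measurableT (intK false)).
have [||_] := @norm_Rintegral_le _ _ _ leb2 (fun y => `|K true y| + `|K false y|) h _ _ mh _ inth.
- by apply: measurable_funD; apply: measurableT_comp.
- by move=> y; rewrite ger0_norm ?addr_ge0.
- exact: le_trans (ler_norm _).
Qed.

End bounded_density.
End velocity_bound.

(** * Heat semigroup *)

Definition conv {R : realType} (f k : R * R -> R) (x : R * R) : R :=
  \int[leb2]_y (f y * k (x - y)).

Section heat_convolution.
Variable R : realType.
Local Notation plane := (measurableTypeR R * measurableTypeR R)%type.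
Variable f : R * R -> R.
Hypothesis f_int : leb2.-integrable [set: plane] (EFin \o f).
Implicit Types (x y z : R * R) (i : bool) (tau : R).

Lemma integrable_conv (k : R * R -> R) B x :
  measurable_fun [set: plane] (fun y : plane => k (x - y)) ->
  (forall z, `|k z| <= B) ->
  leb2.-integrable [set: plane] (EFin \o (fun y => f y * k (x - y))).
Proof.
by move=> mk kB; apply: (@bounded_integrable _ _ _ leb2 f _ B) => // y; exact: kB.
Qed.

(** All derivatives fall on the kernel, so no regularity of [f] enters. *)
Lemma is_derive_conv i (k k' : R * R -> R) B x :
  (forall x, measurable_fun [set: plane] (fun y : plane => k (x - y))) ->
  (forall z, `|k z| <= B) -> (forall z, `|k' z| <= B) ->
  (forall z, is_derive z (unit_vec i) k (k' z)) ->
  is_derive x (unit_vec i) (conv f k) (conv f k' x).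
Proof.
move=> mk kB k'B dk.
rewrite -[x in is_derive x]addr0 -[in is_derive _](scale0r (unit_vec i)).
apply/is_derive_line.
have -> : conv f k' x = conv f k' (x + 0 *: unit_vec i) by rewrite scale0r addr0.
apply: (@is_derive_under_integral _ _ _ leb2 f
  (fun r y => k (x + r *: unit_vec i - y))
  (fun r y => k' (x + r *: unit_vec i - y)) 0 1 B) => //.
move=> r y _.
rewrite (_ : (fun r => _) = (fun r => k ((x - y) + r *: unit_vec i))); last first.
  by apply/funext => q; congr k; rewrite addrAC.
by apply/is_derive_line; rewrite addrAC.
Qed.

Lemma is_derive_conv_heat_x i tau x : 0 < tau ->
  is_derive x (unit_vec i) (conv f (heat tau)) (conv f (heat_x i tau) x).
Proof.
move=> t0; apply: (@is_derive_conv _ _ _ (tau^-1 + tau ^- 2)).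
- exact: measurable_heat_sub.
- by move=> z; exact: norm_heat_le.
- by move=> z; exact: norm_heat_x_le.
- by move=> z; apply: is_derive_heat_x; rewrite gt_eqF.
Qed.

Lemma is_derive_conv_heat_xx i tau x : 0 < tau ->
  is_derive x (unit_vec i) (conv f (heat_x i tau)) (conv f (heat_xx i tau) x).
Proof.
move=> t0; apply: (@is_derive_conv _ _ _ (tau^-1 + tau ^- 2)).
- exact: measurable_heat_x_sub.
- by move=> z; exact: norm_heat_x_le.
- by move=> z; exact: norm_heat_xx_le.
- by move=> z; apply: is_derive_heat_xx; rewrite gt_eqF.
Qed.

Lemma is_derive_conv_heat_t tau x : 0 < tau ->
  is_derive tau 1 (fun tau => conv f (heat tau) x) (conv f (heat_t tau) x).
Proof.
move=> t0; have t20 : 0 < tau / 2 by rewrite divr_gt0.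
(* The window of half-width tau / 2 keeps the time above tau / 2, where the kernel bounds are
   uniform. *)
apply: (@is_derive_under_integral _ _ _ leb2 f
  (fun tau y => heat tau (x - y)) (fun tau y => heat_t tau (x - y)) tau
  (tau / 2) ((tau / 2)^-1 + (tau / 2) ^- 2)) => //.
- by move=> r; exact: measurable_heat_sub.
- by move=> r y /andP[rt _]; apply: norm_heat_le => //; lra.
- by move=> r y /andP[rt _]; apply: is_derive_heat_t; rewrite gt_eqF//; lra.
- by move=> r y /andP[rt _]; apply: norm_heat_t_le => //; lra.
Qed.

Lemma conv_heat_equation tau x : 0 < tau ->
  \sum_i conv f (heat_xx i tau) x = conv f (heat_t tau) x.
Proof.
move=> t0; rewrite big_bool /= /conv -RintegralD//; first last.
- apply: (@integrable_conv _ (tau^-1 + tau ^- 2)) => [|z].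
  + exact: measurable_heat_xx_sub.
  + exact: norm_heat_xx_le.
- apply: (@integrable_conv _ (tau^-1 + tau ^- 2)) => [|z].
  + exact: measurable_heat_xx_sub.
  + exact: norm_heat_xx_le.
apply: eq_Rintegral => y _; rewrite -heat_equation ?gt_eqF// big_bool.
by rewrite mulrDr.
Qed.

Hypothesis f_ge0 : forall y, 0 <= f y.

Lemma conv_heat_ge0 tau x : 0 < tau -> 0 <= conv f (heat tau) x.
Proof.
by move=> t0; apply: Rintegral_ge0 => y _; rewrite mulr_ge0// heat_ge0.
Qed.

Let mf : measurable_fun [set: plane] f.
Proof. by have /integrableP[/measurable_EFinP] := f_int. Qed.

Lemma norm_conv_le (k : R * R -> R) B x :
  measurable_fun [set: plane] (fun y : plane => k (x - y)) ->
  (forall z, `|k z| <= B) -> (\int[leb2]_y (f y)%:E <= 1)%E ->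
  `|conv f k x| <= B.
Proof.
move=> mk kB f1; have B0 : 0 <= B := le_trans (normr_ge0 _) (kB x).
have [||||_] := @norm_Rintegral_le _ _ _ leb2 (fun y => f y * k (x - y))
  (fun y => B * f y) B.
- exact: measurable_funM.
- exact: measurable_funM.
- by move=> y; rewrite normrM (ger0_norm (f_ge0 y)) mulrC ler_wpM2r.
- under eq_integral do rewrite EFinM.
  rewrite ge0_integralZl ?lee_fin//.
  + by rewrite -[leRHS]mule1 lee_wpmul2l ?lee_fin.
  + exact/measurable_EFinP.
  + by move=> y _; rewrite lee_fin.
- by [].
Qed.

Lemma conv_heat_le tau x : 0 < tau -> (\int[leb2]_y (f y)%:E <= 1)%E ->
  conv f (heat tau) x <= (4 * pi * tau)^-1.
Proof.
move=> t0 f1; rewrite (le_trans (ler_norm _))// norm_conv_le//.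
  exact: measurable_heat_sub.
by move=> z; rewrite ger0_norm ?heat_le// heat_ge0.
Qed.

(** In contrast with [norm_conv_le], the sup of [f] is paired with the L^1 norm of the kernel. The
    resulting singularity tau^(-1/2) is integrable at 0, which the supersolution needs. *)
Lemma norm_conv_heat_x_le i tau m x : 0 < tau -> (forall y, f y <= m) ->
  `|conv f (heat_x i tau) x| <= m / Num.sqrt (pi * tau).
Proof.
move=> t0 fm; have m0 : 0 <= m := le_trans (f_ge0 x) (fm x).
have mk : measurable_fun [set: plane] (fun y : plane => heat_x i tau (x - y)).
  exact: measurable_heat_x_sub.
have [||||_] := @norm_Rintegral_le _ _ _ leb2 (fun y => f y * heat_x i tau (x - y))
  (fun y => m * `|heat_x i tau (x - y)|) (m / Num.sqrt (pi * tau)).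
- exact: measurable_funM.
- by apply: measurable_funM => //; apply: measurableT_comp.
- by move=> y; rewrite normrM (ger0_norm (f_ge0 y)) ler_wpM2r.
- under eq_integral do rewrite EFinM.
  rewrite ge0_integralZl ?lee_fin//.
  + by rewrite integral_norm_heat_x// EFinM.
  + by apply/measurable_EFinP; apply: measurableT_comp.
- by [].
Qed.

End heat_convolution.

(** * Joint continuity from bounded partial derivatives *)

Lemma derivative_bound_lipschitz (R : realType) (F F' : R -> R) (L a b : R) :
  (forall r, Num.min a b <= r <= Num.max a b -> is_derive r 1 F (F' r)) ->
  (forall r, Num.min a b <= r <= Num.max a b -> `|F' r| <= L) ->
  `|F a - F b| <= L * `|a - b|.
Proof.
wlog ab : a b / a < b.
  move=> H dF F'L; have [ab|ba|->] := ltgtP a b; first exact: H.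
  - by rewrite distrC [`|a - b|]distrC; apply: H => // r;
      rewrite minC maxC; [exact: dF|exact: F'L].
  - by rewrite !subrr normr0 mulr0.
rewrite min_l ?max_r ?(ltW ab)// => dF F'L.
have dF' r : r \in `]a, b[ -> is_derive r 1 F (F' r).
  by rewrite in_itv/= => /andP[ar rb]; apply: dF; rewrite !ltW.
have [|c cab E] := @MVT _ F F' a b ab dF'.
  apply: derivable_within_continuous => r; rewrite in_itv/= => rab.
  by have [] := dF r rab.
rewrite distrC E normrM [`|b - a|]distrC ler_wpM2r//; apply: F'L.
by move: cab; rewrite in_itv/= => /andP[ac cb]; rewrite !ltW.
Qed.

(** The maximum on the box requires joint continuity, while the comparison functions are
    differentiated one variable at a time. Bounded partial derivatives bridge the gap: a
    displacement is split into three moves, each along one variable. *)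
Lemma bounded_derivatives_continuous (R : realType) (W : R * R -> R -> R)
    (Wx : bool -> R * R -> R -> R) (Wt : R * R -> R -> R) (L s : R)
    (A : set ((R * R) * R)) :
  (forall i x t, s <= t -> is_derive x (unit_vec i) (W ^~ t) (Wx i x t)) ->
  (forall x (t : R), s <= t -> is_derive t 1 (W x) (Wt x t)) ->
  (forall i x t, s <= t -> `|Wx i x t| <= L) ->
  (forall x t, s <= t -> `|Wt x t| <= L) ->
  (forall z, A z -> s <= z.2) ->
  {within A, continuous (fun z : (R * R) * R => W z.1 z.2)}.
Proof.
move=> dWx dWt WxL WtL As.
have line i x t h : s <= t -> `|W (x + h *: unit_vec i) t - W x t| <= L * `|h|.
  move=> st; rewrite -[X in W X t - _]addr0.
  have := @derivative_bound_lipschitz R (fun r => W (x + r *: unit_vec i) t)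
    (fun r => Wx i (x + r *: unit_vec i) t) L h 0.
  rewrite scale0r !addr0 subr0; apply=> r _; last exact: WxL.
  by apply/(is_derive_line (W ^~ t)); exact: dWx.
have L0 t : s <= t -> 0 <= L.
  by move=> st; rewrite (le_trans (normr_ge0 _) (WtL (0, 0) t st)).
apply/subspace_continuousP => z Az; have sz := As z Az.
apply/cvgrPdist_lt => e e0.
have d0 : 0 < e / (3 * (L + 1)).
  by rewrite divr_gt0// mulr_gt0// ltr_wpDl// (L0 z.2 sz).
exists (ball z.1 (e / (3 * (L + 1))), ball z.2 (e / (3 * (L + 1)))) => /=.
  by split; exact: nbhsx_ballx.
move=> [[y1 y2] t] /= [[b1 b2] bt] Ay; have st := As _ Ay; rewrite /= in st.
case: z Az sz b1 b2 bt => [[x1 x2] r] /= Az sz; rewrite /ball/= => b1 b2 bt.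
have h1 := line false (y1, x2) r (x1 - y1) sz.
have h2 := line true (y1, y2) r (x2 - y2) sz.
have h3 : `|W (y1, y2) r - W (y1, y2) t| <= L * `|r - t|.
  apply: (@derivative_bound_lipschitz R _ (Wt (y1, y2))) => q /andP[q1 _].
    by apply: dWt; rewrite (le_trans _ q1)// le_min sz.
  by apply: WtL; rewrite (le_trans _ q1)// le_min sz.
have E1 : (y1, x2) + (x1 - y1) *: unit_vec false = (x1, x2) :> R * R.
  by congr (_, _); rewrite /= /GRing.scale/= ?mulr1 ?mulr0 ?addr0// addrC subrK.
have E2 : (y1, y2) + (x2 - y2) *: unit_vec true = (y1, x2) :> R * R.
  by congr (_, _); rewrite /= /GRing.scale/= ?mulr1 ?mulr0 ?addr0// addrC subrK.
rewrite E1 in h1; rewrite E2 in h2.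
have -> : W (x1, x2) r - W (y1, y2) t = (W (x1, x2) r - W (y1, x2) r) +
   (W (y1, x2) r - W (y1, y2) r) + (W (y1, y2) r - W (y1, y2) t) by ring.
rewrite (le_lt_trans (ler_normD _ _))//.
have := ler_normD (W (x1, x2) r - W (y1, x2) r) (W (y1, x2) r - W (y1, y2) r).
have LL := L0 r sz.
have k (q : R) : `|q| < e / (3 * (L + 1)) -> L * `|q| < e / 3.
  move=> qe; rewrite (@le_lt_trans _ _ ((L + 1) * `|q|))//.
    by rewrite ler_wpM2r// lerDl.
  rewrite -ltr_pdivlMl ?ltr_wpDl// (lt_le_trans qe)//.
  by rewrite invfM mulrA mulrC.
have := k _ b1; have := k _ b2; have := k _ bt; lra.
Qed.

(** * The heat kernel as an approximate identity *)

Section approximate_identity.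
Variable R : realType.
Local Notation plane := (measurableTypeR R * measurableTypeR R)%type.
Implicit Types (x y z : R * R) (i : bool).

Definition rat_box (a b c d : rat) : set plane :=
  `]ratr a, ratr b[%classic `*` `]ratr c, ratr d[%classic.

(** The sigma-algebra of the plane is the product one; an open set belongs to it as the countable
    union of the rational boxes that it contains. *)
Lemma open_measurable_plane (O : set (R * R)) :
  open O -> measurable (O : set plane).
Proof.
move=> oO.
pose B a b c d := if asbool (rat_box a b c d `<=` O) then rat_box a b c d else set0.
have -> : O = \bigcup_a \bigcup_b \bigcup_c \bigcup_d B a b c d.
  rewrite predeqE => x; split; last first.
    by move=> [a _ [b _ [c _ [d _]]]]; rewrite /B; case: asboolP => // s /s.
  move=> Ox; have : nbhs x O by exact: open_nbhs_nbhs.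
  move=> /nbhs_ballP[e /= e0 xeO].
  have rl (r : R) : r - e < r by lra.
  have rr (r : R) : r < r + e by lra.
  have [a] := rat_in_itvoo (rl x.1); have [b] := rat_in_itvoo (rr x.1).
  have [c] := rat_in_itvoo (rl x.2); have [d] := rat_in_itvoo (rr x.2).
  rewrite !in_itv/= => /andP[d1 d2] /andP[c1 c2] /andP[b1 b2] /andP[a1 a2].
  exists a => //; exists b => //; exists c => //; exists d => //.
  rewrite /B asboolT.
    by split; rewrite /= in_itv/=; apply/andP.
  move=> y [] /=; rewrite !in_itv/= => /andP[y1 y2] /andP[y3 y4].
  by apply: xeO; split; rewrite /ball/= ltr_distl; apply/andP; split; lra.
do 4 (apply: bigcupT_measurable_rat => ?).
by rewrite /B; case: ifP => // _; exact: measurableX.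
Qed.

Lemma continuous_measurable_plane (f : R * R -> R) :
  continuous f -> measurable_fun [set: plane] f.
Proof.
move=> /continuousP cf; apply: (measurability _ (RGenOpens.measurableE R)).
move=> _ [_ [a [b ->] <-]]; rewrite setTI; apply: open_measurable_plane.
exact/cf/interval_open.
Qed.

(** Half of the exponent is spent on smallness, by e^(-w) <= 1/w, and the other half leaves the
    kernel at time [2 * e], of mass 1. No integral over the tail has to be estimated. *)
Lemma heat_far e d z : 0 < e -> 0 < d -> d ^+ 2 <= sqnorm z ->
  heat e z <= 16 * e / d ^+ 2 * heat (2 * e) z.
Proof.
move=> e0 d0 dz; have d20 : 0 < d ^+ 2 by rewrite exprn_gt0.
have z0 : 0 < sqnorm z := lt_le_trans d20 dz.
pose w := sqnorm z / (8 * e).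
have w0 : 0 < w by rewrite divr_gt0 ?mulr_gt0.
have -> : heat e z = 2 * expR (- w) * heat (2 * e) z.
  rewrite /heat (_ : - (sqnorm z / (4 * e)) = - w + - w); last first.
    by rewrite /w; field; rewrite gt_eqF.
  rewrite (_ : - (sqnorm z / (4 * (2 * e))) = - w); last first.
    by rewrite /w; field; rewrite gt_eqF.
  rewrite expRD; move: (@pi_neq0 R) (expR _); move: pi => p p0 E.
  by field; rewrite p0 gt_eqF.
rewrite ler_wpM2r ?heat_ge0 ?mulr_gt0//.
have : expR (- w) <= w^-1.
  by rewrite -[leRHS]mul1r ler_pdivlMr// mulrC xexpRN_le1// ltW.
have : w^-1 <= 8 * e / d ^+ 2.
  by rewrite /w invf_div ler_wpM2l// ?lef_pV2 ?posrE// mulr_ge0// ltW.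
by move=> h1 h2; rewrite (_ : 16 * e / d ^+ 2 = 2 * (8 * e / d ^+ 2));
  [lra | ring].
Qed.

(** Heine-Cantor by compactness, with only [x] confined to the box: the convolution integrates over
    all [y]. *)
Lemma continuous_uniform_on_box (f : R * R -> R) (a eta : R) :
  continuous f -> 0 < eta ->
  exists2 d, 0 < d & forall x y, (forall i, `|coord i x| <= a) ->
    ball x d y -> f x <= f y + eta.
Proof.
move=> cf eta0.
pose K : set (R * R) := `[- a, a]%classic `*` `[- a, a]%classic.
have cK : compact K by apply: compact_setX; exact: segment_compact.
have /compact_near_coveringP/(_ R (0^'+) (fun d x =>
  forall y, ball x d y -> f x <= f y + eta)) := cK.
case=> [|].
  move=> x Kx; have /cvgrPdist_lt/(_ (eta / 2)) := cf x.
  rewrite divr_gt0// => /(_ isT) /nbhs_ballP[r /= r0 H].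
  have r20 : 0 < r / 2 by rewrite divr_gt0.
  exists (ball x (r / 2), [set d | 0 < d] `&` [set d | d < r / 2]) => /=.
    split; first exact: nbhsx_ballx.
    by apply: filterI; [exact: nbhs_right_gt|exact: nbhs_right_lt].
  move=> [x' d] /= [xx' [d0 dr]] y x'y.
  have h1 := H x'; have h2 := H y.
  have rr : r / 2 + r / 2 = r by lra.
  have b1 : ball x r x' by rewrite -rr; apply: (le_ball _ xx'); rewrite lerDl ltW.
  have b2 : ball x r y.
    by rewrite -rr; apply: (ball_triangle xx'); apply: (le_ball _ x'y); exact: ltW.
  have := h1 b1; have := h2 b2; rewrite !ltr_distl => /andP[? ?] /andP[? ?]; lra.
move=> d /= d0 H; exists (d / 2); first by rewrite divr_gt0.
move=> x y xa; apply: (H (d / 2)).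
- by rewrite /= sub0r normrN gtr0_norm ?divr_gt0//; lra.
- by rewrite divr_gt0.
- by split; rewrite /= in_itv/= -ler_norml; [exact: (xa false)|exact: (xa true)].
Qed.

(** Since the kernel has mass 1, [f x] is itself an integral against it. Close to [x] uniform
    continuity compares it with [f y]; far away [f x <= M] and [heat_far] apply. Only this one-sided
    estimate is needed for the initial comparison. *)
Lemma conv_heat_approx (f : R * R -> R) (a M eta : R) :
  continuous f -> leb2.-integrable [set: plane] (EFin \o f) ->
  (forall y, 0 <= f y) -> (forall y, f y <= M) -> 0 < eta ->
  exists2 e0, 0 < e0 & forall e x, 0 < e < e0 -> (forall i, `|coord i x| <= a) ->
    f x <= conv f (heat e) x + eta.
Proof.
move=> cf intf f0 fM eta0.
have M0 : 0 <= M := le_trans (f0 (0, 0)) (fM (0, 0)).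
have eta20 : 0 < eta / 2 by rewrite divr_gt0.
have [d d0 fd] := @continuous_uniform_on_box f a (eta / 2) cf eta20.
have d20 : 0 < d ^+ 2 by rewrite exprn_gt0.
(* Chosen so that the far contribution 16 M e / d^2 is at most eta / 2; [M + 1] avoids a division by
   0. *)
exists (eta * d ^+ 2 / (32 * (M + 1))).
  by rewrite divr_gt0 ?mulr_gt0// ltr_wpDl.
move=> e x /andP[e0 ee0] xa.
pose c := M * (16 * e / d ^+ 2).
have ce : c <= eta / 2.
  rewrite /c; move: ee0; rewrite ltr_pdivlMr ?mulr_gt0 ?ltr_wpDl// => h.
  rewrite mulrA ler_pdivrMr//; nra.
have ih tau : 0 < tau ->
    leb2.-integrable [set: plane] (EFin \o (fun y : plane => heat tau (x - y))).
  move=> t0; apply/integrableP; split.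
    by apply/measurable_EFinP; exact: measurable_heat_sub.
  under eq_integral do rewrite /= ger0_norm ?heat_ge0//.
  by rewrite integral_heat// ltry.
have h1 tau : 0 < tau -> \int[leb2]_y heat tau (x - y) = 1.
  by move=> t0; rewrite /Rintegral integral_heat.
have e20 : 0 < 2 * e by rewrite mulr_gt0.
have hZ k tau : 0 < tau -> \int[leb2]_y (k * heat tau (x - y)) = k.
  by move=> t0; rewrite RintegralZl ?h1 ?mulr1//; exact: ih.
rewrite -[leLHS](hZ _ e e0).
have int1 : leb2.-integrable [set: plane] (EFin \o (fun y : plane => f y * heat e (x - y))).
  apply: (@integrable_conv _ _ intf _ (e^-1 + e ^- 2)) => [|z].
    exact: measurable_heat_sub.
  exact: norm_heat_le.
have intZ k tau : 0 < tau ->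
    leb2.-integrable [set: plane] (EFin \o (fun y : plane => k * heat tau (x - y))).
  by move=> t0; exact: (integrableZl measurableT k (ih tau t0)).
have int2 := integrableD measurableT (intZ (eta / 2) e e0) (intZ c (2 * e) e20).
have int3 := integrableD measurableT int1 int2.
apply: (@le_trans _ _ (\int[leb2]_y (f y * heat e (x - y) +
   (eta / 2 * heat e (x - y) + c * heat (2 * e) (x - y))))).
  apply: le_Rintegral => //; first exact: intZ.
  move=> y _.
  have [xy|nxy] := pselect (ball x d y).
    rewrite addrA -mulrDl -[leLHS]addr0 lerD//.
      by rewrite ler_wpM2r ?heat_ge0// fd.
    by rewrite mulr_ge0 ?heat_ge0// mulr_ge0// divr_ge0 ?(ltW d20)// mulr_ge0// ltW.
  have dz : d ^+ 2 <= sqnorm (x - y).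
    rewrite leNgt; apply/negP => h; apply: nxy; split; rewrite /ball/=.
      rewrite -(@ltr_pXn2r _ 2) ?nnegrE ?(ltW d0)//.
      by rewrite (le_lt_trans _ h)// (norm_coord_sqr_le false (x - y)).
    rewrite -(@ltr_pXn2r _ 2) ?nnegrE ?(ltW d0)//.
    by rewrite (le_lt_trans _ h)// (norm_coord_sqr_le true (x - y)).
  have hf := heat_far e0 d0 dz; have hp := heat_ge0 (x - y) e0.
  have : f x * heat e (x - y) <= c * heat (2 * e) (x - y).
    rewrite /c -mulrA (le_trans (ler_wpM2r hp (fM x)))//.
    by rewrite ler_wpM2l.
  have : 0 <= f y * heat e (x - y) by rewrite mulr_ge0.
  have : 0 <= eta / 2 * heat e (x - y) by rewrite mulr_ge0 ?(ltW eta20).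
  by move: (_ * _) (_ * _) (_ * _) (_ * _) => A1 A2 A3 A4; lra.
rewrite RintegralD//.
rewrite RintegralD//; [|exact: intZ|exact: intZ].
by rewrite !hZ// /conv; move: (\int[_]_y _) => A; lra.
Qed.

End approximate_identity.

(** * Vorticity equation *)

Definition drift_speed {R : realType} (m : R) : R := 5 / (2 * pi) * Num.sqrt m.

(** The factor 2 comes from integrating tau^(-1/2): [drift m * sqrt tau] is the time integral of
    [drift_speed m * m / sqrt (pi tau)]. *)
Definition drift {R : realType} (m : R) : R :=
  2 * drift_speed m * m / Num.sqrt pi.

(** The q of the overview: the heat term and the drift term at time 1 / (4 m), each divided by m. *)
Definition decay_rate {R : realType} : R :=
  pi^-1 + 5 / (2 * (pi * Num.sqrt pi)).

Definition decay_const {R : realType} : R :=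
  (4 * (1 - decay_rate) * decay_rate)^-1.

(** The summand [2 * c] makes the Gaussian at least as wide as the one in [initial_layer]; the 8
    ensures that [8 * t] plus the shift is at least max(t, 1). *)
Definition gauss_shift {R : realType} (c : R) : R := 8 + 2 * c.

Definition sup_const {R : realType} (c : R) : R :=
  8 * decay_const + gauss_shift c * (2 * c).

(* The first term makes the Gaussian dominate rho inside |x|^2 <= r^2 (8 t + C),
   the second one at the initial time. *)
Definition gauss_mass {R : realType} (c : R) : R :=
  pi * sup_const c * expR ((drift_speed (sup_const c) + 2) ^+ 2)
  + 2 * c * pi * (8 + gauss_shift c).

(** * Elementary inequalities and numerical constants *)

Section constants.
Variable R : realType.

Lemma drift_ge0 (m : R) : 0 <= m -> 0 <= drift m.
Proof.
move=> m0; rewrite divr_ge0 ?sqrtr_ge0// !mulr_ge0 ?invr_ge0 ?sqrtr_ge0//.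
by rewrite mulr_ge0 ?pi_ge0.
Qed.

Lemma large_box (m e : R) (x : R * R) : 0 < m -> 0 < e ->
  exists a, m < e * a ^+ 2 /\ forall i, `|coord i x| <= a.
Proof.
move=> m0 e0; have me : 0 < m / e by rewrite divr_gt0.
pose a := 1 + `|x.1| + `|x.2| + m / e.
have n1 := normr_ge0 x.1; have n2 := normr_ge0 x.2.
exists a; split; last by case; rewrite /coord /a; lra.
rewrite mulrC -ltr_pdivrMr//.
have a1 : 1 <= a by rewrite /a; lra.
by rewrite (@lt_le_trans _ _ a)//; [rewrite /a; lra | rewrite expr2 ler_peMl//; lra].
Qed.

(** The Engel form of the Cauchy-Schwarz inequality. It controls the heat flow of a Gaussian without
    computing a convolution of Gaussians. *)
Lemma titu (a b p q : R) : 0 < p -> 0 < q ->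
  (a + b) ^+ 2 / (p + q) <= a ^+ 2 / p + b ^+ 2 / q.
Proof.
move=> p0 q0; rewrite ler_pdivrMr ?addr_gt0//.
have -> : (a ^+ 2 / p + b ^+ 2 / q) * (p + q) =
  (a + b) ^+ 2 + (a * q - b * p) ^+ 2 / (p * q) by field; rewrite !gt_eqF.
by rewrite lerDl divr_ge0 ?sqr_ge0// mulr_ge0// ltW.
Qed.

Lemma le_sqrt_limit (a b c t0 : R) : 0 <= c -> 0 < t0 ->
  (forall s, 0 < s <= t0 -> a <= b + c * Num.sqrt s) -> a <= b.
Proof.
move=> c0 t00 H; rewrite leNgt; apply/negP => ba.
pose q := (a - b) / (2 * (c + 1)).
have q0 : 0 < q by rewrite divr_gt0 ?subr_gt0// mulr_gt0// ltr_wpDl.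
pose s := Num.min t0 (q ^+ 2).
have s0 : 0 < s by rewrite lt_min t00 exprn_gt0.
have sq : Num.sqrt s <= q.
  rewrite -[leRHS](ger0_norm (ltW q0)) -sqrtr_sqr ler_sqrt ?sqr_ge0//.
  by rewrite ge_min lexx orbT.
have := H s; rewrite s0 ge_min lexx => /(_ isT).
have := ler_wpM2l c0 sq.
have : c * q < a - b.
  rewrite /q mulrA ltr_pdivrMr ?mulr_gt0 ?ltr_wpDl//.
  by move: ba c0; move: (a) (b) (c) => a' b' c' *; nra.
by move: (c * q) (c * _) => *; lra.
Qed.

Lemma sqrtrD_le (a b : R) : 0 <= a -> 0 <= b ->
  Num.sqrt (a + b) <= Num.sqrt a + Num.sqrt b.
Proof.
move=> a0 b0; have q0 : 0 <= Num.sqrt a + Num.sqrt b by rewrite addr_ge0 ?sqrtr_ge0.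
rewrite -[leRHS](ger0_norm q0) -sqrtr_sqr ler_sqrt ?sqr_ge0// sqrrD !sqr_sqrtr//.
by rewrite lerD2r lerDl mulrn_wge0// mulr_ge0 ?sqrtr_ge0.
Qed.

Lemma sin_sqr_le (a : R) : sin a ^+ 2 <= a ^+ 2.
Proof.
have : `|sin a| <= `|a|.
  have := @derivative_bound_lipschitz R sin cos 1 a 0 (fun r _ => is_derive_sin r).
  by rewrite sin0 !subr0 mul1r; apply=> r _; rewrite ler_norml cos_geN1 cos_le1.
by rewrite -(@ler_pXn2r _ 2) ?nnegrE// !real_normK ?num_real.
Qed.

(** From cos (pi / 2) = 0 one gets sin^2 (pi / 4) = 1/2, and sin^2 a <= a^2. *)
Lemma pi_sqr_ge8 : 8 <= pi ^+ 2 :> R.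
Proof.
have := cos_mulr2n (pi / 4 : R).
have -> : (pi / 4) *+ 2 = pi / 2 :> R.
  by rewrite mulr2n; move: (@pi R) => p; field.
rewrite cos_pihalf => h.
have := cos2Dsin2 (pi / 4 : R); have := sin_sqr_le (pi / 4).
have -> : (pi / 4) ^+ 2 = pi ^+ 2 / 16 :> R.
  by move: (@pi R) => p; field.
by move: h; rewrite mulr2n; move: (cos _ ^+ 2) (sin _ ^+ 2) (pi ^+ 2) => *; lra.
Qed.

(* Numerically decay_rate is about 0.77; the bound 8 <= pi^2 suffices. *)
Lemma decay_rate_lt1 : 0 < (decay_rate : R) < 1.
Proof.
have p0 := @pi_gt0 R; have p8 := pi_sqr_ge8.
have p28 : 14 / 5 <= pi :> R.
  rewrite -(@ler_pXn2r _ 2) ?nnegrE ?(ltW p0)// (le_trans _ p8)//.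
  by rewrite expr_div_n ler_pdivrMr// -!natrX -natrM ler_nat.
have w0 : 0 < Num.sqrt pi :> R by rewrite sqrtr_gt0.
have w16 : 8 / 5 <= Num.sqrt pi :> R.
  rewrite -(@ler_pXn2r _ 2) ?nnegrE ?(ltW w0)// sqr_sqrtr ?(ltW p0)//.
  by rewrite (le_trans _ p28)// expr_div_n; lra.
have d0 : 0 < 2 * (pi * Num.sqrt pi) :> R by rewrite !mulr_gt0.
apply/andP; split; first by rewrite addr_gt0 ?invr_gt0// divr_gt0.
rewrite /decay_rate.
have -> : pi^-1 = 2 * Num.sqrt pi / (2 * (pi * Num.sqrt pi)) :> R.
  by move: p0 w0; move: (Num.sqrt (@pi R)) (@pi R) => w p *; field; rewrite !gt_eqF.
rewrite -mulrDl ltr_pdivrMr// mul1r.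
(* What remains is 2 w + 5 < 2 p w, that is 5 < 2 w (p - 1), and 2 (8/5) (9/5) = 5.76. *)
by move: p28 w16; move: (Num.sqrt (@pi R)) (@pi R) => w p *; nra.
Qed.

Lemma decay_const_gt0 : 0 < (decay_const : R).
Proof.
have /andP[q0 q1] := decay_rate_lt1.
by rewrite invr_gt0 !mulr_gt0// subr_gt0.
Qed.

End constants.

(** * Comparison principles for the vorticity *)

Section vorticity.
Variables (R : realType) (rho0 : R * R -> R) (rho : R * R -> R -> R).
Hypothesis sol : NS_vorticity_solution rho0 rho.
Local Notation plane := (measurableTypeR R * measurableTypeR R)%type.
Local Notation u := (fun i x t => velocity (rho ^~ t) i x).

Lemma rho_continuous t : 0 < t -> continuous (rho ^~ t).
Proof.
move=> t0 x; have [_ d _ _] := @NS_regular _ _ _ sol x t t0.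
exact/differentiable_continuous/(d [::]).
Qed.

Lemma rho_measurable t : 0 < t -> measurable_fun [set: plane] (rho ^~ t).
Proof. by move=> t0; apply: continuous_measurable_plane; exact: rho_continuous. Qed.

Lemma rho_integrable t :
  0 < t -> leb2.-integrable [set: plane] (EFin \o (rho ^~ t)).
Proof.
move=> t0; apply/integrableP; split.
  by apply/measurable_EFinP; exact: rho_measurable.
under eq_integral do rewrite /= ger0_norm ?(NS_ge0 sol _ (ltW t0))//.
by rewrite (NS_mass sol (ltW t0)) ltry.
Qed.

Lemma sum_velocity_le t m x : 0 < t -> 0 < m -> (forall y, rho y t <= m) ->
  \sum_(i : bool) `|u i x t| <= drift_speed m.
Proof.
move=> t0 m0 rm; apply: velocity_le => //.
- exact: rho_measurable.
- by move=> y; exact: (NS_ge0 sol _ (ltW t0)).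
- by rewrite (NS_mass sol (ltW t0)).
Qed.

Lemma norm_velocity_le i t m x : 0 < t -> 0 < m -> (forall y, rho y t <= m) ->
  `|u i x t| <= drift_speed m.
Proof.
move=> t0 m0 rm; rewrite (le_trans _ (sum_velocity_le x t0 m0 rm))//.
by rewrite big_bool; case: i; rewrite /= ?lerDl ?lerDr.
Qed.

(** The box has been removed: a violation at one point fixes [e] so that the barrier there is half
    of the violation, and the box is chosen afterwards. Continuity is asked on every set because [a]
    is not known beforehand. *)
Lemma comparison (W : R * R -> R -> R) (Wx Wxx : bool -> R * R -> R -> R)
    (Wt : R * R -> R -> R) (s T m : R) :
  0 < s -> 0 < m -> (forall x t, s <= t <= T -> rho x t <= m) ->
  (forall x t, s <= t <= T -> 0 <= W x t) ->
  (forall i x t, s < t <= T -> is_derive x (unit_vec i) (W ^~ t) (Wx i x t)) ->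
  (forall i x t, s < t <= T -> is_derive x (unit_vec i) (Wx i ^~ t) (Wxx i x t)) ->
  (forall x (t : R), s < t <= T -> is_derive t 1 (W x) (Wt x t)) ->
  (forall A : set ((R * R) * R), (forall z, A z -> s <= z.2) ->
    {within A, continuous (fun z : (R * R) * R => W z.1 z.2)}) ->
  (forall x t, s < t <= T -> W x t < rho x t ->
    0 <= Wt x t + \sum_(i : bool) u i x t * Wx i x t - \sum_(i : bool) Wxx i x t) ->
  (forall x, rho x s <= W x s) ->
  forall x t, s <= t <= T -> rho x t <= W x t.
Proof.
move=> s0 m0 rm W0 dWx dWxx dWt cW Wsup Wini x t stT.
have uU i y r : s <= r <= T -> `|u i y r| <= drift_speed m.
  move=> /[dup] srT /andP[sr _].
  by apply: norm_velocity_le => // [|z]; [exact: lt_le_trans sr|exact: rm].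
pose K := expR ((2 * drift_speed m + 5) * (t - s)) * (1 + sqnorm x).
have K0 : 0 < K by rewrite mulr_gt0 ?expR_gt0// ltr_pwDl ?sqnorm_ge0.
rewrite leNgt; apply/negP => Wr.
pose e := (rho x t - W x t) / (2 * K).
have e0 : 0 < e by rewrite divr_gt0 ?subr_gt0// mulr_gt0.
have [a [mea xa]] := large_box x m0 e0.
have cWa : {within (`[- a, a] `*` `[- a, a]) `*` `[s, T],
    continuous (fun z : (R * R) * R => W z.1 z.2)}.
  by apply: cW => z [_]; rewrite /= in_itv/= => /andP[].
have Wini' y : (forall i, `|coord i y| <= a) -> rho y s <= W y s + e.
  by move=> _; rewrite (le_trans (Wini y))// lerDl ltW.
have := @maximum_principle_box R rho u (NS_regular sol) (NS_equation sol) s T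
  (drift_speed m) m s0 uU rm W Wx Wxx Wt a e e0 mea W0 dWx dWxx dWt cWa Wsup
  Wini' x t stT xa.
have eK : e * K = (rho x t - W x t) / 2.
  by rewrite /e invfM -!mulrA mulVf ?gt_eqF// mulr1.
rewrite /barrier -mulrA -/K eK.
by move: Wr; move: (rho x t) (W x t) => p q; lra.
Qed.

Lemma sup_nonincreasing s t m : 0 < s -> s <= t -> 0 < m ->
  (forall x, rho x s <= m) -> forall x, rho x t <= m.
Proof.
move=> s0 st m0 rm x.
(* The crude bound [M] only determines the size of the box; the constant [m], being a solution, is
   the comparison function. *)
have [M rM] := NS_bounded sol t.
pose M' := Num.max M m.
have M'0 : 0 < M' by rewrite lt_max m0 orbT.
apply: (@comparison (fun _ _ => m) (fun _ _ _ => 0) (fun _ _ _ => 0) (fun _ _ => 0)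
  s t M') => //.
- move=> y r /andP[sr rt]; rewrite le_max rM//.
  by rewrite rt (le_trans (ltW s0)).
- by move=> y r _; exact: ltW.
- by move=> i y r _; exact: is_derive_cst.
- by move=> i y r _; exact: is_derive_cst.
- by move=> A _; apply: continuous_subspaceT => z; exact: cvg_cst.
- by move=> y r _ _; rewrite big1 ?big1 ?addr0 ?subr0// => i _; rewrite mulr0.
- by rewrite st lexx.
Qed.

(* The heat flow of rho(s) is a supersolution once it is corrected by the time
   integral of |u|_oo |grad|_oo, where |grad (heat tau * rho(s))|_oo is at most
   m / sqrt (pi tau). *)
Lemma heat_flow_comparison s t m x d : 0 < s -> s <= t -> 0 < m -> 0 < d ->
  (forall y r, s <= r <= t -> rho y r <= m) ->
  exists2 e, 0 < e < d & rho x t <= conv (rho ^~ s) (heat (t - s + e)) x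
    + drift m * Num.sqrt (t - s + e) + d.
Proof.
move=> s0 st m0 d0 rm.
have sst : s <= s <= t by rewrite lexx.
have f0 y : 0 <= rho y s by exact: (NS_ge0 sol _ (ltW s0)).
have fm y : rho y s <= m by exact: rm.
have fint := rho_integrable s0.
have f1 : (\int[leb2]_y (rho y s)%:E <= 1)%E by rewrite (NS_mass sol (ltW s0)).
have uU i y r : s <= r <= t -> `|u i y r| <= drift_speed m.
  move=> /[dup] srT /andP[sr _].
  by apply: norm_velocity_le => // [|z]; [exact: lt_le_trans sr|exact: rm].
pose K := expR ((2 * drift_speed m + 5) * (t - s)) * (1 + sqnorm x).
have K0 : 0 < K by rewrite mulr_gt0 ?expR_gt0// ltr_pwDl ?sqnorm_ge0.
(* With this initial slack the barrier at the point [(x, t)] equals [d]. *)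
pose eta := d / K.
have eta0 : 0 < eta by rewrite divr_gt0.
have [a [mea xa]] := large_box x m0 eta0.
have [e0 e00 approx] := @conv_heat_approx _ (rho ^~ s) a m eta (rho_continuous s0)
  fint f0 fm eta0.
(* The kernel time is shifted by [e], so that it never reaches the singular time 0; at time [s] the
   shift costs at most [eta]. *)
pose e := Num.min e0 d / 2.
have min0 : 0 < Num.min e0 d by rewrite lt_min e00.
have e_gt0 : 0 < e by rewrite divr_gt0.
have ee0 : e < e0.
  have : Num.min e0 d <= e0 by rewrite ge_min lexx.
  by rewrite /e; move: min0; move: (Num.min _ _) => q; lra.
have ed : e < d.
  have : Num.min e0 d <= d by rewrite ge_min lexx orbT.
  by rewrite /e; move: min0; move: (Num.min _ _) => q; lra.
exists e; first by rewrite e_gt0.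
pose W x r := conv (rho ^~ s) (heat (r - s + e)) x + drift m * Num.sqrt (r - s + e).
pose Wx i x r := conv (rho ^~ s) (heat_x i (r - s + e)) x.
pose Wxx i x r := conv (rho ^~ s) (heat_xx i (r - s + e)) x.
pose Wt x r := conv (rho ^~ s) (heat_t (r - s + e)) x
  + drift m * (2 * Num.sqrt (r - s + e))^-1.
have tau0 r : s <= r -> 0 < r - s + e by lra.
have taue r : s <= r -> e <= r - s + e by lra.
have dWx i y r : s <= r -> is_derive y (unit_vec i) (W ^~ r) (Wx i y r).
  move=> sr; have h := @is_derive_conv_heat_x _ _ fint i _ y (tau0 r sr).
  rewrite -[Wx i y r]addr0.
  exact: (is_deriveD h (is_derive_cst (drift m * Num.sqrt (r - s + e)) y _)).
have dWxx i y r : s <= r -> is_derive y (unit_vec i) (Wx i ^~ r) (Wxx i y r).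
  by move=> sr; exact: (@is_derive_conv_heat_xx _ _ fint i _ y (tau0 r sr)).
have dtau (r : R) : is_derive r 1 (fun r => r - s + e) 1.
  by apply: is_derive_eq; rewrite subr0 addr0.
have dWt y (r : R) : s <= r -> is_derive r 1 (W y) (Wt y r).
  move=> sr; rewrite /W /Wt.
  have h1 := @is_derive1_comp R (fun tau => conv (rho ^~ s) (heat tau) y)
    (fun r => r - s + e) r _ _ (@is_derive_conv_heat_t _ _ fint _ y (tau0 r sr)) (dtau r).
  have h2 := @is_derive1_comp R Num.sqrt (fun r => r - s + e) r _ _
    (is_derive1_sqrt (tau0 r sr)) (dtau r).
  rewrite !mulr1 in h1 h2.
  exact: (is_deriveD h1 (is_deriveZ (drift m) h2)).
pose L := e^-1 + e ^- 2 + drift m * (2 * Num.sqrt e)^-1.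
have dm0 : 0 <= drift m by rewrite drift_ge0// ltW.
have L1 : e^-1 + e ^- 2 <= L.
  by rewrite lerDl mulr_ge0// invr_ge0 mulr_ge0// sqrtr_ge0.
have WxL i y r : s <= r -> `|Wx i y r| <= L.
  move=> sr; rewrite (le_trans _ L1)// norm_conv_le//.
    exact: measurable_heat_x_sub.
  by move=> z; apply: norm_heat_x_le => //; exact: taue.
have WtL y r : s <= r -> `|Wt y r| <= L.
  move=> sr; rewrite (le_trans (ler_normD _ _))// lerD//.
    rewrite norm_conv_le//; first exact: measurable_heat_t_sub.
    by move=> z; apply: norm_heat_t_le => //; exact: taue.
  rewrite normrM (ger0_norm dm0) ler_wpM2l// ger0_norm ?invr_ge0 ?mulr_ge0 ?sqrtr_ge0//.
  rewrite lef_pV2 ?posrE ?mulr_gt0 ?sqrtr_gt0 ?tau0// ler_pM2l// ler_sqrt ?taue//.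
  by rewrite ltW ?tau0.
have W0 y r : s <= r <= t -> 0 <= W y r.
  move=> /andP[sr _]; rewrite addr_ge0//; first by rewrite conv_heat_ge0// tau0.
  by rewrite mulr_ge0// sqrtr_ge0.
have cWa : {within (`[- a, a] `*` `[- a, a]) `*` `[s, t],
    continuous (fun z : (R * R) * R => W z.1 z.2)}.
  apply: (@bounded_derivatives_continuous R W Wx Wt L s) => //.
  by move=> z [_]; rewrite /= in_itv/= => /andP[].
have Wsup y r : s < r <= t -> W y r < rho y r ->
    0 <= Wt y r + \sum_(i : bool) u i y r * Wx i y r - \sum_(i : bool) Wxx i y r.
  move=> /andP[/ltW sr rt] _; rewrite conv_heat_equation ?tau0// /Wt.
  set q := Num.sqrt (pi * (r - s + e)).
  have grad i : `|Wx i y r| <= m / q by apply: norm_conv_heat_x_le => //; exact: tau0.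
  have sumU : \sum_i `|u i y r| <= drift_speed m.
    apply: sum_velocity_le => //; first exact: lt_le_trans sr.
    by move=> z; apply: rm; rewrite sr.
  have : `|\sum_(i : bool) u i y r * Wx i y r| <= drift_speed m * (m / q).
    rewrite (le_trans (ler_norm_sum _ _ _))//.
    apply: (@le_trans _ _ (\sum_(i : bool) `|u i y r| * (m / q))).
      by apply: ler_sum => i _; rewrite normrM ler_wpM2l.
    by rewrite -mulr_suml ler_wpM2r// (le_trans _ (grad true)).
  rewrite ler_norml => /andP[+ _].
  (* The time derivative of the correction equals the bound on the drift term. *)
  have -> : drift m * (2 * Num.sqrt (r - s + e))^-1 = drift_speed m * (m / q).
    rewrite /q sqrtrM ?pi_ge0// /drift; move: (tau0 r sr); rewrite -sqrtr_gt0.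
    have : 0 < Num.sqrt pi :> R by rewrite sqrtr_gt0 pi_gt0.
    move: (Num.sqrt (@pi R)) (Num.sqrt (r - s + e)) (drift_speed m) => p w v p0 w0.
    by field; rewrite !gt_eqF.
  by move: (\sum_i _) (conv _ _ _) (_ * _) => A B C; lra.
have Wini y : (forall i, `|coord i y| <= a) -> rho y s <= W y s + eta.
  move=> ya; rewrite /W subrr add0r.
  rewrite (le_trans (approx e y _ ya)) ?e_gt0//.
  by rewrite lerD2r lerDl mulr_ge0// sqrtr_ge0.
have := @maximum_principle_box R rho u (NS_regular sol) (NS_equation sol) s t
  (drift_speed m) m s0 uU rm W Wx Wxx Wt a eta eta0 mea W0 _ _ _ cWa Wsup
  Wini x t _ xa.
rewrite /barrier -mulrA -/K /eta mulfVK ?gt_eqF//; apply.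
- by move=> i y r /andP[/ltW sr _]; exact: dWx.
- by move=> i y r /andP[/ltW sr _]; exact: dWxx.
- by move=> y r /andP[/ltW sr _]; exact: dWt.
- by rewrite st lexx.
Qed.

(** * Pointwise bounds near the initial time *)

Section initial_time.
Variable C3 : R.
Hypothesis C3_gt0 : 0 < C3.
Hypothesis rho0_density : probability_density rho0.
Hypothesis rho0_le : forall x, rho0 x <= C3 * expR (- (C3^-1 * sqnorm x)).

Let rho0_ge0 x : 0 <= rho0 x. Proof. by case: rho0_density. Qed.

Let rho0_integrable : leb2.-integrable [set: plane] (EFin \o rho0).
Proof.
case: rho0_density => mrho0 _ int0; apply/integrableP; split.
  exact/measurable_EFinP.
under eq_integral do rewrite /= ger0_norm//.
by rewrite int0 ltry.
Qed.

(** Half of the heat exponent and half of that of the initial bound combine, by [titu], into a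
    Gaussian in [x]. The other half of the heat exponent leaves the kernel at time [2 * tau], of
    mass 1; the 2 is the ratio of the prefactors. *)
Lemma conv_heat_initial_le tau x : 0 < tau ->
  conv rho0 (heat tau) x <= 2 * C3 * expR (- (sqnorm x / (2 * C3 + 8 * tau))).
Proof.
move=> t0; set E := expR _.
have t20 : 0 < 2 * tau by rewrite mulr_gt0.
have E0 : 0 <= E by exact: expR_ge0.
have ih : leb2.-integrable [set: plane] (EFin \o (fun y : plane => heat (2 * tau) (x - y))).
  apply/integrableP; split.
    by apply/measurable_EFinP; exact: measurable_heat_sub.
  under eq_integral do rewrite /= ger0_norm ?heat_ge0//.
  by rewrite integral_heat// ltry.
have -> : 2 * C3 * E = \int[leb2]_y (2 * C3 * E * heat (2 * tau) (x - y)).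
  by rewrite RintegralZl// /Rintegral integral_heat// mulr1.
apply: le_Rintegral => //.
- apply: (@integrable_conv _ _ rho0_integrable _ (tau^-1 + tau ^- 2)) => [|z].
    exact: measurable_heat_sub.
  exact: norm_heat_le.
- exact: (integrableZl measurableT (2 * C3 * E) ih).
move=> y _; rewrite (le_trans (ler_wpM2r (heat_ge0 _ t0) (rho0_le y)))//.
have key : - (C3^-1 * sqnorm y) - sqnorm (x - y) / (4 * tau) <=
    - (sqnorm x / (2 * C3 + 8 * tau)) - sqnorm (x - y) / (4 * (2 * tau)).
  have C320 : 0 < 2 * C3 by rewrite mulr_gt0.
  have t80 : 0 < 8 * tau by rewrite mulr_gt0.
  have h1 := titu y.1 (x.1 - y.1) C320 t80.
  have h2 := titu y.2 (x.2 - y.2) C320 t80.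
  rewrite addrC subrK in h1; rewrite addrC subrK in h2.
  have e1 : sqnorm (x - y) / (4 * tau) = 2 * (sqnorm (x - y) / (8 * tau)).
    by field; rewrite gt_eqF.
  have e2 : C3^-1 * sqnorm y = 2 * (sqnorm y / (2 * C3)) by field; rewrite gt_eqF.
  have e3 : 4 * (2 * tau) = 8 * tau by ring.
  have p : 0 <= sqnorm y / (2 * C3) by rewrite divr_ge0 ?sqnorm_ge0// ltW.
  rewrite e1 e2 e3; move: h1 h2 p; rewrite /sqnorm /= !mulrDl.
  by move: (_ / _) (_ / _) (_ / _) (_ / _) (_ / _) (_ / _) => A B C D F G; lra.
rewrite /heat mulrACA -expRD mulrACA -expRD.
have -> : 2 * C3 * (4 * pi * (2 * tau))^-1 = C3 * (4 * pi * tau)^-1.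
  by move: (@pi_neq0 R); move: pi => p p0; field; rewrite p0 gt_eqF.
rewrite ler_wpM2l ?ler_expR//.
by rewrite mulr_ge0 ?(ltW C3_gt0)// invr_ge0 !mulr_ge0 ?pi_ge0// ltW.
Qed.

Lemma initial_L1_small (eta : R) : 0 < eta -> \forall s \near 0^'+,
  (\int[leb2]_x `|rho x s - rho0 x|%:E < eta%:E)%E.
Proof.
move=> eta0; have /(_ [set y | (y < eta%:E)%E]) H := NS_initial_cvg sol; apply: H.
exists eta => //= r /=; rewrite sub0r normrN lte_fin => h.
exact: le_lt_trans (ler_norm _) h.
Qed.

(** The kernel is bounded by 1 / tau, so closeness in L^1 becomes pointwise closeness after
    convolution, as long as [tau] stays away from 0. *)
Lemma conv_sub_le s tau eta x : 0 < s -> 0 < tau ->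
  (\int[leb2]_x `|rho x s - rho0 x|%:E < eta%:E)%E ->
  conv (rho ^~ s) (heat tau) x <= conv rho0 (heat tau) x + tau^-1 * eta.
Proof.
move=> s0 t0 small; rewrite addrC -lerBlDr.
have B z : `|heat tau z| <= tau^-1.
  rewrite ger0_norm ?heat_ge0// (le_trans (heat_le_inv _ t0))//.
  by rewrite ler_piMr ?invr_ge0 ?(ltW t0)// invf_le1// ler1n.
have ti0 : 0 <= tau^-1 by rewrite invr_ge0 ltW.
have mh := measurable_heat_sub tau x.
have mr := rho_measurable s0.
have [mr0 _ _] := rho0_density.
have int1 := integrable_conv (rho_integrable s0) mh B.
have int2 := integrable_conv rho0_integrable mh B.
rewrite /conv -RintegralB//.
rewrite (le_trans (ler_norm _))//.
have mabs : measurable_fun [set: plane] (fun y => `|rho y s - rho0 y|).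
  by apply: measurableT_comp => //; exact: measurable_funB.
have [||||_] := @norm_Rintegral_le _ _ _ leb2
  (fun y => rho y s * heat tau (x - y) - rho0 y * heat tau (x - y))
  (fun y => tau^-1 * `|rho y s - rho0 y|) (tau^-1 * eta).
- by apply: measurable_funB; exact: measurable_funM.
- exact: measurable_funM.
- by move=> y; rewrite -mulrBl normrM mulrC ler_wpM2r.
- under eq_integral do rewrite EFinM.
  rewrite ge0_integralZl ?lee_fin//; last exact/measurable_EFinP.
  by rewrite EFinM lee_wpmul2l ?lee_fin// ltW.
- by [].
Qed.

Lemma initial_layer M t x : 0 < M -> 0 < t ->
  (forall y r, 0 <= r <= t -> rho y r <= M) ->
  rho x t <= 2 * C3 * expR (- (sqnorm x / (2 * C3 + 8 * t)))
    + drift M * Num.sqrt t.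
Proof.
move=> M0 t0 rM; set G := _ + _; rewrite leNgt; apply/negP => Gr.
pose d := rho x t - G; have d0 : 0 < d by rewrite subr_gt0.
have t20 : 0 < t / 2 by rewrite divr_gt0.
(* As [tau] will be at least [t / 2], the L^1 error contributes at most [d / 4]. *)
pose eta := t / 2 * (d / 4).
have eta0 : 0 < eta by rewrite !mulr_gt0// invr_gt0.
have d40 : 0 < d / 4 by rewrite divr_gt0.
near (0 : R)^'+ => s.
have s0 : 0 < s by near: s; exact: nbhs_right_gt.
have st2 : s < t / 2 by near: s; exact: nbhs_right_lt.
have sd : s < d / 4 by near: s; exact: nbhs_right_lt.
have small : (\int[leb2]_x `|rho x s - rho0 x|%:E < eta%:E)%E.
  by near: s; exact: initial_L1_small.
have st : s <= t by lra.
have rM' y r : s <= r <= t -> rho y r <= M.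
  by move=> /andP[sr rt]; apply: rM; rewrite rt (le_trans (ltW s0)).
(* The starting time [s] also serves as the error tolerance: then [e < s], so the kernel time [tau]
   does not exceed [t]. *)
have [e /andP[e0 es]] := heat_flow_comparison x s0 st M0 s0 rM'.
set tau := t - s + e => h.
have tau0 : 0 < tau by rewrite /tau; lra.
have taut : tau <= t by rewrite /tau; lra.
have t2tau : t / 2 <= tau by rewrite /tau; lra.
have h1 := conv_sub_le x s0 tau0 small.
have h2 := conv_heat_initial_le x tau0.
have h3 : expR (- (sqnorm x / (2 * C3 + 8 * tau))) <=
    expR (- (sqnorm x / (2 * C3 + 8 * t))).
  rewrite ler_expR lerN2 ler_wpM2l ?sqnorm_ge0//.
  have := C3_gt0 => c0.
  by rewrite lef_pV2 ?posrE; lra.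
have h4 : drift M * Num.sqrt tau <= drift M * Num.sqrt t.
  rewrite ler_wpM2l ?drift_ge0 ?(ltW M0)//.
  by rewrite ler_sqrt// ltW.
have h5 : tau^-1 * eta <= d / 4.
  rewrite /eta mulrA ler_piMl ?(ltW d40)// mulrC ler_pdivrMr// mul1r.
  exact: t2tau.
have C320 : 0 <= 2 * C3 by rewrite mulr_ge0// ltW.
have h6 := ler_wpM2l C320 h3.
have dE : rho x t = G + d by rewrite /d; lra.
rewrite /G in dE; move: dE h h1 h2 h4 h5 h6 sd d0.
move: (rho x t) (conv _ _ _) (conv _ _ _) (2 * C3 * _) (2 * C3 * _) => A B D F H.
move: (drift M * _) (drift M * _) (tau^-1 * eta) => I J K.
by clear; move=> *; lra.
Unshelve. all: by end_near. Qed.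

(** * Decay of the supremum *)

Lemma rho_le_initial t x : 0 < t -> rho x t <= 2 * C3.
Proof.
move=> t0; have [M' rM'] := NS_bounded sol t.
pose M := Num.max M' 1; have M0 : 0 < M by rewrite lt_max ltr01 orbT.
have rM y r : 0 <= r <= t -> rho y r <= M by move=> rt; rewrite le_max rM'.
have dM : 0 <= drift M by rewrite drift_ge0// ltW.
(* At a small time [s] the initial layer gives the bound up to [drift M * sqrt s]; monotonicity of
   the supremum carries it to [t], and then [s] tends to 0. *)
apply: (@le_sqrt_limit R _ _ (drift M) t dM t0) => s /andP[s0 st].
apply: (sup_nonincreasing s0 st).
  by rewrite ltr_pwDl ?mulr_gt0// mulr_ge0// sqrtr_ge0.
move=> y; rewrite (le_trans (initial_layer y M0 s0 _))//.
  by move=> z r /andP[r0 rs]; apply: rM; rewrite r0 (le_trans rs).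
rewrite lerD2r ler_piMr ?mulr_ge0 ?(ltW C3_gt0)//.
rewrite -[leRHS]expR0 ler_expR oppr_le0 divr_ge0 ?sqnorm_ge0// addr_ge0//.
  by rewrite mulr_ge0// ltW.
by rewrite mulr_ge0// ltW.
Qed.

Lemma sup_decay_step s t m : 0 < s -> 0 < m -> s + (4 * m)^-1 <= t ->
  (forall x, rho x s <= m) -> forall x, rho x t <= decay_rate * m.
Proof.
move=> s0 m0 st rm.
have m40 : 0 < (4 * m)^-1 by rewrite invr_gt0 mulr_gt0.
have /andP[q0 _] := (@decay_rate_lt1 R).
pose t1 := s + (4 * m)^-1.
have t1E : t1 - s = (4 * m)^-1 by rewrite /t1; ring.
have st1 : s <= t1 by rewrite lerDl ltW.
(* The estimate is made exactly at [t1]; monotonicity covers the later times. *)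
apply: (sup_nonincreasing (lt_le_trans s0 st1) st); first by rewrite mulr_gt0.
move=> x; have dm : 0 <= drift m by rewrite drift_ge0// ltW.
apply: (@le_sqrt_limit R _ _ (drift m + 1) 1) => //; first by rewrite addr_ge0.
move=> d /andP[d0 d1].
have rm' y r : s <= r <= t1 -> rho y r <= m.
  by move=> /andP[sr _]; exact: (sup_nonincreasing s0 sr m0 rm).
have [e /andP[e0 ed]] := heat_flow_comparison x s0 st1 m0 d0 rm'.
rewrite t1E => h; rewrite (le_trans h)//.
have tau0 : 0 < (4 * m)^-1 + e by rewrite addr_gt0.
have h1 : conv (rho ^~ s) (heat ((4 * m)^-1 + e)) x <= m / pi.
  apply: (le_trans (conv_heat_le (rho_integrable s0) _ x tau0 _)).
  - by move=> y; exact: (NS_ge0 sol _ (ltW s0)).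
  - by rewrite (NS_mass sol (ltW s0)).
  - have -> : m / pi = (4 * pi * (4 * m)^-1)^-1.
      move: (@pi_neq0 R); move: (@pi R) => p p0.
      by field; rewrite p0 gt_eqF.
    by rewrite lef_pV2 ?posrE ?mulr_gt0 ?pi_gt0// ler_pM2l ?mulr_gt0 ?pi_gt0// lerDl ltW.
have h2 : Num.sqrt ((4 * m)^-1 + e) <= Num.sqrt (4 * m)^-1 + Num.sqrt d.
  rewrite (le_trans (sqrtrD_le (ltW m40) (ltW e0)))// lerD2l ler_sqrt ?ltW//.
have h3 : drift m * Num.sqrt (4 * m)^-1 = m * (5 / (2 * (pi * Num.sqrt pi))).
  have -> : Num.sqrt (4 * m)^-1 = (2 * Num.sqrt m)^-1.
    have -> : (4 * m)^-1 = (2 * Num.sqrt m)^-1 ^+ 2.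
      by rewrite exprVn exprMn sqr_sqrtr ?(ltW m0)// -natrX.
    by rewrite sqrtr_sqr ger0_norm// invr_ge0 mulr_ge0// sqrtr_ge0.
  rewrite /drift /drift_speed.
  have : 0 < Num.sqrt m by rewrite sqrtr_gt0.
  have : 0 < Num.sqrt (@pi R) by rewrite sqrtr_gt0 pi_gt0.
  have := @pi_neq0 R.
  move: (Num.sqrt m) (Num.sqrt (@pi R)) (@pi R) => v w p p0 w0 v0.
  by field; rewrite p0 !gt_eqF.
have h4 : d <= Num.sqrt d.
  rewrite -[leLHS](sqr_sqrtr (ltW d0)) expr2 ler_piMr ?sqrtr_ge0//.
  by rewrite -sqrtr1 ler_sqrt.
have h5 := ler_wpM2l dm h2; rewrite mulrDr h3 in h5.
have -> : decay_rate * m = m / pi + m * (5 / (2 * (pi * Num.sqrt pi))).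
  by rewrite /decay_rate mulrC mulrDr.
rewrite (mulrDl (drift m)) mul1r; move: h1 h4 h5.
move: (conv _ _ _) (m / pi) (m * _) (drift m) (Num.sqrt (_ + e)) (Num.sqrt d).
by move=> A B C D E F *; lra.
Qed.

(** The bounds m_k = 2 C3 q^k hold from the times L / m_k on, since L / m_k + 1 / (4 m_k) <= L /
    m_(k+1). Up to the next such time, rho t is at most m_k L / m_(k+1) = L / q, which no longer
    involves C3. *)
Lemma rho_decay t x : 0 < t -> rho x t <= decay_const / t.
Proof.
have /andP[q0 q1] := (@decay_rate_lt1 R).
have q10 : 0 < 1 - (decay_rate : R) by rewrite subr_gt0.
pose L : R := (4 * (1 - decay_rate))^-1.
have L0 : 0 < L by rewrite invr_gt0 mulr_gt0.
have NE : decay_const = L / decay_rate by rewrite /L -invfM.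
pose m k := 2 * C3 * decay_rate ^+ k.
have m0 k : 0 < m k by rewrite !mulr_gt0// exprn_gt0.
have bound k : forall r y, L / m k <= r -> rho y r <= m k.
  elim: k => [|k IH] r y Lr.
    rewrite /m expr0 mulr1 rho_le_initial// (lt_le_trans _ Lr)//.
    by rewrite divr_gt0.
  have -> : m k.+1 = decay_rate * m k by rewrite /m exprS; ring.
  have Lk0 : 0 < L / m k by rewrite divr_gt0.
  apply: (sup_decay_step Lk0 (m0 k)); last by move=> z; exact: IH.
  rewrite (le_trans _ Lr)//.
  have -> : m k.+1 = decay_rate * m k by rewrite /m exprS; ring.
  have -> : L / m k + (4 * m k)^-1 = (L + 4^-1) / m k.
    by rewrite (invfM 4) -mulrDl.
  rewrite (invfM (@decay_rate R)) mulrA ler_pM2r ?invr_gt0// ler_pdivlMr// /L invfM.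
  move: q0 q10; move: (@decay_rate R) => q q0 q10.
  have -> : (4^-1 * (1 - q)^-1 + 4^-1) * q = 4^-1 * (1 - q)^-1 - 4^-1 * (1 - q).
    by field; rewrite gt_eqF.
  by rewrite gerBl mulr_ge0// ltW.
move=> t0; rewrite ler_pdivlMr// NE.
(* The induction locates the interval between consecutive thresholds that contains [t]; before the
   first threshold the uniform bound [m 0] suffices. *)
have dec k : t <= L / m k -> rho x t * t <= L / decay_rate.
  elim: k => [|k IH] tk.
    apply: (@le_trans _ _ (m 0%N * (L / m 0%N))).
      apply: ler_pM => //; [exact: (NS_ge0 sol _ (ltW t0))|exact: ltW|].
      by rewrite /m expr0 mulr1 rho_le_initial.
    rewrite mulrCA divff ?gt_eqF// mulr1 ler_peMr ?(ltW L0)//.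
    by rewrite invf_ge1// ltW.
  have [/IH//|kt] := leP t (L / m k).
  apply: (@le_trans _ _ (m k * (L / m k.+1))).
    apply: ler_pM => //; [exact: (NS_ge0 sol _ (ltW t0))|exact: ltW|].
    by apply: bound; exact: ltW.
  have -> : m k.+1 = decay_rate * m k by rewrite /m exprS; ring.
  rewrite le_eqVlt; apply/orP; left; apply/eqP.
  move: (m0 k) q0; move: (m k) (@decay_rate R) => a q a0 q0.
  by field; rewrite !gt_eqF.
(* The thresholds tend to infinity because q^k tends to 0. *)
suff [k tk] : exists k, t <= L / m k by exact: dec tk.
have : (decay_rate : R) ^+ n @[n --> \oo] --> 0.
  by apply: cvg_expr; rewrite ger0_norm ?ltW.
have e0 : 0 < L / (t * (2 * C3)) by rewrite divr_gt0 ?mulr_gt0.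
move=> /cvgrPdist_lt/(_ _ e0)[k _ /(_ k (leqnn k))] /=.
rewrite sub0r normrN ger0_norm ?exprn_ge0 ?(ltW q0)// => h.
exists k; rewrite ler_pdivlMr// /m mulrA mulrC -ler_pdivlMr ?mulr_gt0//.
exact: ltW.
Qed.

(** * Gaussian bound *)

Let C : R := gauss_shift C3.
Let N : R := sup_const C3.
Let A : R := gauss_mass C3.

Let CE : C = 8 + 2 * C3. Proof. by []. Qed.
Let NE : N = 8 * decay_const + C * (2 * C3). Proof. by []. Qed.
Let AE : A = pi * N * expR ((drift_speed N + 2) ^+ 2) + 2 * C3 * pi * (8 + C).
Proof. by []. Qed.

Let C_gt0 : 0 < C.
Proof. by rewrite CE addr_gt0// mulr_gt0. Qed.

Let N_gt0 : 0 < N.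
Proof.
rewrite NE; apply: addr_gt0; apply: mulr_gt0 => //; first exact: decay_const_gt0.
by rewrite mulr_gt0.
Qed.

(** Merges the bounds for small and large times into one whose scale, 8 t + C, is that of the
    Gaussian, so that the drift speed becomes k / v with v^2 = 8 t + C. *)
Lemma rho_le_uniform t x : 0 < t -> rho x t <= N / (8 * t + C).
Proof.
move=> t0; have th : 0 < 8 * t + C by rewrite addr_gt0// mulr_gt0.
rewrite ler_pdivlMr// mulrDr NE lerD//.
  by rewrite mulrCA ler_wpM2l// -ler_pdivlMr// rho_decay.
by rewrite mulrC ler_wpM2l ?rho_le_initial// ltW.
Qed.

(** The time derivative of the kernel is [2 * heat_t], of which one [heat_t] cancels the Laplacian.
    With r = |x| / v, the other is (4 / v^2) (r^2 - 1) times the kernel, and the drift at most (4 /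
    v^2) (k r / 2) times it; the former wins for r >= k + 2. *)
Lemma gaussian_supersolution t x : 0 < t -> A * heat (2 * t + C / 4) x < rho x t ->
  0 <= heat_t (2 * t + C / 4) x + \sum_(i : bool) u i x t * heat_x i (2 * t + C / 4) x.
Proof.
move=> t0; set tau := 2 * t + C / 4; set v := Num.sqrt (8 * t + C) => Wr.
have th : 0 < 8 * t + C by rewrite addr_gt0// mulr_gt0.
have tauE : tau = v ^+ 2 / 4.
  by rewrite /v sqr_sqrtr ?(ltW th)// /tau; field.
have v0 : 0 < v by rewrite sqrtr_gt0.
have tau0 : 0 < tau by rewrite tauE divr_gt0// exprn_gt0.
set k := drift_speed N.
have k0 : 0 <= k.
  by rewrite mulr_ge0 ?sqrtr_ge0// divr_ge0// mulr_ge0// pi_ge0.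
pose w := Num.sqrt (sqnorm x).
have w2 : w ^+ 2 = sqnorm x by rewrite sqr_sqrtr// sqnorm_ge0.
have w0 : 0 <= w by exact: sqrtr_ge0.
have h0 := heat_ge0 x tau0.
(* For r < k + 2 the factor [expR ((k + 2) ^+ 2)] in [A] outweighs e^(-r^2), so that [A * heat] is
   at least N / v^2 and hence at least [rho], against the hypothesis. *)
have far : (k + 2) * v <= w.
  rewrite leNgt; apply/negP => wk; move: Wr; apply/negP; rewrite -leNgt.
  rewrite (le_trans (rho_le_uniform x t0))//.
  apply: (@le_trans _ _ (pi * N * expR ((k + 2) ^+ 2) * heat tau x)); last first.
    rewrite ler_wpM2r// AE lerDl !mulr_ge0 ?pi_ge0 ?(ltW C3_gt0)//.
    by rewrite addr_ge0// ltW.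
  rewrite /heat (_ : 4 * pi * tau = pi * (8 * t + C)); last first.
    by rewrite /tau; move: (@pi R) => p; field.
  have -> : pi * N * expR ((k + 2) ^+ 2) * ((pi * (8 * t + C))^-1 *
      expR (- (sqnorm x / (4 * tau)))) = N / (8 * t + C) *
      (expR ((k + 2) ^+ 2) * expR (- (sqnorm x / (4 * tau)))).
    move: th (@pi_neq0 R); move: (@pi R) (8 * t + C) (expR _) (expR _).
    by move=> p q E F q0 p0; field; rewrite p0 gt_eqF.
  rewrite -expRD ler_peMr ?divr_ge0 ?(ltW N_gt0) ?(ltW th)//.
  rewrite -[leLHS]expR0 ler_expR subr_ge0 ler_pdivrMr ?mulr_gt0//.
  rewrite tauE (_ : 4 * (v ^+ 2 / 4) = v ^+ 2); last by field.
  rewrite -exprMn -w2 ler_pXn2r ?nnegrE ?(ltW wk)//.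
  by rewrite mulr_ge0 ?addr_ge0 ?(ltW v0).
have sumU : \sum_(i : bool) `|u i x t| <= k / v.
  have Nth : 0 < N / (8 * t + C) by rewrite divr_gt0.
  have := sum_velocity_le x t0 Nth (fun y => rho_le_uniform y t0).
  have -> : drift_speed (N / (8 * t + C)) = k / v; last by [].
  have -> : N / (8 * t + C) = (Num.sqrt N / v) ^+ 2.
    by rewrite expr_div_n !sqr_sqrtr ?(ltW th) ?(ltW N_gt0).
  rewrite /k /drift_speed sqrtr_sqr ger0_norm ?divr_ge0 ?sqrtr_ge0//.
  by rewrite mulrA.
have hx i : `|heat_x i tau x| <= 2 * w / v ^+ 2 * heat tau x.
  rewrite /heat_x normrM normrN (ger0_norm h0) ler_wpM2r// normrM normfV.
  rewrite (gtr0_norm (mulr_gt0 _ tau0))//.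
  have -> : 2 * w / v ^+ 2 = w / (2 * tau) by rewrite tauE; field; rewrite gt_eqF.
  rewrite ler_wpM2r ?invr_ge0 ?mulr_ge0 ?(ltW tau0)//.
  by rewrite -(@ler_pXn2r _ 2) ?nnegrE// w2 (norm_coord_sqr_le i x).
have : `|\sum_(i : bool) u i x t * heat_x i tau x| <=
    k / v * (2 * w / v ^+ 2 * heat tau x).
  rewrite (le_trans (ler_norm_sum _ _ _))//.
  apply: (@le_trans _ _ (\sum_(i : bool) `|u i x t| * (2 * w / v ^+ 2 * heat tau x))).
    by apply: ler_sum => i _; rewrite normrM ler_wpM2l.
  by rewrite -mulr_suml ler_wpM2r// (le_trans _ (hx true)).
rewrite ler_norml => /andP[+ _].
have -> : heat_t tau x = 4 / v ^+ 2 * ((w / v) ^+ 2 - 1) * heat tau x.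
  by rewrite /heat_t -w2 tauE; field; rewrite gt_eqF.
have -> : k / v * (2 * w / v ^+ 2 * heat tau x) =
    4 / v ^+ 2 * (k * (w / v) / 2) * heat tau x.
  by field; rewrite gt_eqF.
have r0 : k + 2 <= w / v by rewrite ler_pdivlMr.
have : 0 <= 4 / v ^+ 2 * ((w / v) ^+ 2 - 1 - k * (w / v) / 2) * heat tau x.
  rewrite mulr_ge0// mulr_ge0//; first by rewrite divr_ge0// ltW// exprn_gt0.
  have r2 : 0 <= w / v by rewrite divr_ge0// ltW.
  have := mulr_ge0 r2 k0; have : 0 <= w / v * (w / v - k - 2).
    by rewrite mulr_ge0//; lra.
  by clearbody k; move: r0 k0 r2; move: (w / v) => r *; lra.
move: (\sum_i _) (4 / v ^+ 2) ((w / v) ^+ 2) (k * _ / 2) (heat tau x).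
by move=> *; lra.
Qed.

Lemma gaussian_bound t x : 0 < t ->
  rho x t <= gauss_mass C3 * heat (2 * t + gauss_shift C3 / 4) x.
Proof.
rewrite -/A -/C => t0; have [M' rM'] := NS_bounded sol t.
pose M := Num.max M' 1; have M0 : 0 < M by rewrite lt_max ltr01 orbT.
have rM y r : 0 <= r <= t -> rho y r <= M by move=> rt; rewrite le_max rM'.
have dM : 0 <= drift M by rewrite drift_ge0// ltW.
have m0 : 0 < Num.min t 1 by rewrite lt_min t0 ltr01.
have A0 : 0 <= A.
  rewrite AE addr_ge0//; rewrite !mulr_ge0 ?pi_ge0 ?expR_ge0 ?(ltW N_gt0) ?(ltW C3_gt0)//.
  by rewrite addr_ge0// ltW.
(* The cap [s <= 1] lets one constant [A] dominate 2 C3 pi (8 s + C), as the initial comparison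
   requires. *)
apply: (@le_sqrt_limit R _ _ (drift M) _ dM m0) => s /andP[s0].
rewrite le_min => /andP[st s1].
pose tau r := 2 * r + C / 4.
have C40 : 0 < C / 4 by rewrite divr_gt0.
have tauC r : s <= r -> C / 4 <= tau r by rewrite /tau; move: s0 C40 => *; lra.
have tau0 r : s <= r -> 0 < tau r by move=> sr; exact: lt_le_trans (tauC r sr).
have taun r : s <= r -> tau r != 0 by move=> sr; rewrite gt_eqF ?tau0.
(* The added constant absorbs the error of [initial_layer] at the starting time [s], and vanishes as
   [s] tends to 0. *)
pose W y r := A * heat (tau r) y + drift M * Num.sqrt s.
pose Wx i y r := A * heat_x i (tau r) y.
pose Wxx i y r := A * heat_xx i (tau r) y.
pose Wt y r := A * (heat_t (tau r) y * 2).
have dWx i y r : s <= r -> is_derive y (unit_vec i) (W ^~ r) (Wx i y r).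
  move=> sr; have h := is_derive_heat_x i y (taun r sr).
  rewrite -[Wx i y r]addr0.
  exact: (is_deriveD (is_deriveZ A h) (is_derive_cst (drift M * Num.sqrt s) y _)).
have dWxx i y r : s <= r -> is_derive y (unit_vec i) (Wx i ^~ r) (Wxx i y r).
  by move=> sr; exact: (is_deriveZ A (is_derive_heat_xx i y (taun r sr))).
have dtau (r : R) : is_derive r 1 tau 2.
  rewrite -[2]addr0; apply: is_deriveD; rewrite -[X in is_derive _ _ _ X]mulr1.
  exact: (is_deriveZ 2 (is_derive_id r 1)).
have dWt y (r : R) : s <= r -> is_derive r 1 (W y) (Wt y r).
  move=> sr.
  have h := @is_derive1_comp R (heat ^~ y) tau r _ _
    (is_derive_heat_t y (taun r sr)) (dtau r).
  rewrite -[Wt y r]addr0.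
  exact: (is_deriveD (is_deriveZ A h) (is_derive_cst (drift M * Num.sqrt s) r 1)).
pose B := (C / 4)^-1 + (C / 4) ^- 2.
have B0 : 0 <= B by rewrite addr_ge0 ?invr_ge0 ?exprn_ge0 ?(ltW C40).
have WxL i y r : s <= r -> `|Wx i y r| <= A * (B * 2).
  move=> sr; rewrite normrM (ger0_norm A0) ler_wpM2l//.
  rewrite (le_trans (norm_heat_x_le i y C40 (tauC r sr)))//.
  by rewrite -/B; lra.
have WtL y r : s <= r -> `|Wt y r| <= A * (B * 2).
  move=> sr; rewrite normrM (ger0_norm A0) ler_wpM2l// normrM (ger0_norm (ler0n _ 2)).
  by rewrite ler_wpM2r// norm_heat_t_le// tauC.
have st' : s <= t <= t by rewrite st lexx.
have C320 : 0 < 2 * C3 by rewrite mulr_gt0.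
have Wcomp := @comparison W Wx Wxx Wt s t (2 * C3) s0 C320.
apply: Wcomp; last exact: st'.
- by move=> y r /andP[sr _]; rewrite rho_le_initial// (lt_le_trans s0).
- move=> y r /andP[sr _]; rewrite addr_ge0// mulr_ge0 ?sqrtr_ge0//.
  by rewrite heat_ge0// tau0.
- by move=> i y r /andP[/ltW sr _]; exact: dWx.
- by move=> i y r /andP[/ltW sr _]; exact: dWxx.
- by move=> y r /andP[/ltW sr _]; exact: dWt.
- move=> S Ss; exact: (@bounded_derivatives_continuous R W Wx Wt (A * (B * 2)) s).
- move=> y r /andP[/ltW sr _] Wr.
  have r0 : 0 < r := lt_le_trans s0 sr.
  have Wr' : A * heat (tau r) y < rho y r.
    by rewrite (le_lt_trans _ Wr)// lerDl mulr_ge0// sqrtr_ge0.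
  have := gaussian_supersolution r0 Wr'; rewrite -/(tau r) => /(mulr_ge0 A0).
  rewrite /Wx /Wxx /Wt -mulr_sumr heat_equation ?taun//.
  have -> : \sum_i u i y r * (A * heat_x i (tau r) y) =
      A * \sum_i u i y r * heat_x i (tau r) y.
    by rewrite mulr_sumr; apply: eq_bigr => i _; rewrite mulrCA.
  rewrite mulrDr; move: (\sum_i _) (heat_t _ _) => D E.
  by lra.
- move=> y; rewrite (le_trans (initial_layer y M0 s0 _))//.
    by move=> z r /andP[r0 rs]; apply: rM; rewrite r0 (le_trans rs).
  rewrite /W lerD2r /heat.
  have -> : 4 * tau s = 8 * s + C by rewrite /tau; field.
  have th : 0 < 8 * s + C by rewrite addr_gt0// mulr_gt0.
  have piE : 4 * pi * tau s = pi * (8 * s + C) by rewrite /tau; move: (@pi R) => p; field.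
  rewrite piE mulrA; apply: ler_pM; rewrite ?expR_ge0 ?(ltW C320)//.
    rewrite ler_pdivlMr ?mulr_gt0 ?pi_gt0//.
    apply: (@le_trans _ _ (2 * C3 * pi * (8 + C))).
      rewrite -mulrA ler_pM2l// ler_pM2l ?pi_gt0// lerD2r; move: s1 => ?; lra.
    by rewrite AE lerDr !mulr_ge0 ?pi_ge0 ?expR_ge0 ?(ltW N_gt0).
  rewrite ler_expR lerN2 ler_wpM2l ?sqnorm_ge0//.
  by rewrite lef_pV2 ?posrE ?addr_gt0 ?mulr_gt0// CE; move: s0 => ?; lra.
Qed.

Lemma gauss_mass_gt0 : 0 < gauss_mass C3.
Proof.
rewrite -/A AE; apply: addr_gt0; rewrite !mulr_gt0 ?pi_gt0 ?expR_gt0//.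
by rewrite addr_gt0.
Qed.

End initial_time.
End vorticity.

Theorem lemma4p3 (R : realType) (C3 : R) (hC3 : 0 < C3) :
  exists2 C2' : R, 0 < C2' &
    forall (C1 C2 : R) (rho0 : R * R -> R) (rho : R * R -> R -> R),
      0 < C1 -> 0 < C2 ->
      W2oo rho0 ->
      probability_density rho0 ->
      grad_log_bound C1 rho0 ->
      hess_log_bound C2 rho0 ->
      (forall x : R * R, rho0 x <= C3 * expR (- (C3^-1 * sqnorm x))) ->
      NS_vorticity_solution rho0 rho ->
      forall (x : R * R) (t : R), 0 <= t ->
        rho x t <= C2' / Num.max t 1 * expR (- (sqnorm x / (8 * t + C2'))).
Proof.
have A0 := gauss_mass_gt0 hC3.
have Ap0 : 0 < gauss_mass C3 / pi by rewrite divr_gt0 ?pi_gt0.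
have CE : gauss_shift C3 = 8 + 2 * C3 by [].
move: A0 Ap0 CE (@gaussian_bound R) => A0 Ap0 CE bound.
set C := gauss_shift C3 in CE *.
have C0 : 0 < C by rewrite CE; lra.
(* The first summand is the prefactor of the Gaussian, the second its shift; enlarging either
   weakens the bound, so their sum can take both places. *)
exists (gauss_mass C3 / pi + C); first by rewrite addr_gt0.
move=> C1 C2 rho0 rho _ _ _ dens _ _ rho0_le sol x t.
set K := gauss_mass C3 / pi + C.
have CK : C <= K by rewrite lerDr ltW.
have K0 : 0 < K := lt_le_trans C0 CK.
(* At [t = 0] the claim follows from the assumed bound on [rho0], as [C3] is below the new
   constant. *)
rewrite le_eqVlt => /predU1P[<-|t0].
  rewrite (NS_initial sol) max_r// divr1 mulr0 add0r (le_trans (rho0_le x))//.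
  have C3K : C3 <= K by rewrite (le_trans _ CK)// CE; lra.
  apply: ler_pM => //; rewrite ?expR_ge0 ?(ltW hC3)//.
  rewrite ler_expR lerN2 [leRHS]mulrC ler_wpM2l ?sqnorm_ge0//.
  by rewrite lef_pV2 ?posrE.
have th : 0 < 8 * t + C by rewrite addr_gt0// mulr_gt0.
have thK : 8 * t + C <= 8 * t + K by rewrite lerD2l.
have m0 : 0 < Num.max t 1 by rewrite lt_max t0.
rewrite (le_trans (bound rho0 rho sol C3 hC3 dens rho0_le t x t0))//.
rewrite -/C /heat (_ : 4 * (2 * t + C / 4) = 8 * t + C); last by field.
have -> : 4 * pi * (2 * t + C / 4) = pi * (8 * t + C).
  by move: (@pi R) => p; field.
rewrite mulrA invfM mulrA; apply: ler_pM; rewrite ?expR_ge0//.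
- by rewrite mulr_ge0 ?invr_ge0 ?(ltW th)// ltW.
- apply: ler_pM; rewrite ?invr_ge0 ?(ltW th) ?(ltW Ap0)//.
    by rewrite lerDl ltW.
  rewrite lef_pV2 ?posrE// ge_max; apply/andP; split.
    by move: t0 C0 => *; lra.
  by rewrite CE; move: t0 hC3 => *; lra.
rewrite ler_expR lerN2 ler_wpM2l ?sqnorm_ge0//.
by rewrite lef_pV2 ?posrE// (lt_le_trans th).
Qed.
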